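(* Let $P$ be a stationary random field on $\Omega=\Upsilon^{\mathbb Z^2}$ satisfying the strong $0$-$1$ law and condition (B). Fix $\lambda\in[0,1]$ and reals $x<\tilde x$. For $b\in\mathbb R$ and $n\in\mathbb N$ let $$L_n(b)=\big\{(z,\lfloor\lambda z+nb\rfloor):\ z\in\mathbb Z\cap[nx,n\tilde x]\big\},$$ the lattice approximation of the $n$-fold blowup of the segment $\{(s,\lambda s+b):s\in[x,\tilde x]\}$. Then $$\sup_{b\in\mathbb R}\Big\|\frac{1}{|L_n(b)|}\mathcal I\big(P_{L_n(b)}\big)-h_\lambda(P)\Big\|_{L^1(P)}\xrightarrow[n\to\infty]{}0.$$
   Context: $\Upsilon$ finite, $\Omega=\Upsilon^{\mathbb Z^2}$ with product $\sigma$-algebra; $\omega_V$ restriction, $\mathcal F_V=\sigma(\omega_V)$; stationary = shift-invariant. $\mathcal I(P_V)(\omega)=-\log P[\omega_V]$, $P[\omega_V]=P(\{\eta:\eta_V=\omega_V\})$. $P_0[\cdot\mid\mathcal G](\omega)$ conditional law of $\omega_{(0,0)}$ given $\mathcal G$; $H(\mu)=-\sum_y\mu(y)\log\mu(y)$. Strong $0$-$1$ law: for every $J\subseteq\mathbb Z^2$, $\mathcal F_J=\bigcap_{V\text{ finite}}\mathcal F_{J\cup(\mathbb Z^2\setminus V)}$ mod $P$. Condition (B): there is $c_0>0$ with $P(\omega_{(0,0)}=y\mid A)>c_0$ for all $y\in\Upsilon$, $A\in\mathcal F_{\mathbb Z^2\setminus\{(0,0)\}}$ with $P(A)>0$. For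 $\lambda,a\in\mathbb R$ and $U\subseteq\mathbb Z$: $L_{\lambda,a}(U)=\{(z,\lfloor\lambda z+a\rfloor):z\in U\}$. Past $\sigma$-algebra $\mathcal P_{\lambda,t}=\mathcal F_{L_{\lambda,t}(\{-1,-2,\dots\})}$. Specific entropy along slope $\lambda$: $h_\lambda(P)=\int_0^1E_P\big[H(P_0[\cdot\mid\mathcal P_{\lambda,t}])\big]dt$. *)

(* Defs.v *)
From HB Require Import structures.
From mathcomp Require Import all_boot all_order all_algebra.
From mathcomp Require Import all_classical all_reals all_analysis.
Import Order.TTheory GRing.Theory Num.Theory.
Local Open Scope classical_set_scope.
Local Open Scope ring_scope.

Definition Z2 : Type := (int * int)%type.
Definition origin : Z2 := (0%Z, 0%Z).
Definition addZ2 (v u : Z2) : Z2 := (v.1 + u.1, v.2 + u.2)%R.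

(* The finite alphabet Upsilon (a copy of U made pointed by u0, needed only
   so that the configuration space is a pointedType). *)
Definition Alph (U : finType) (u0 : U) : Type := U.
HB.instance Definition _ (U : finType) (u0 : U) := Finite.on (Alph U u0).
HB.instance Definition _ (U : finType) (u0 : U) := isPointed.Build (Alph U u0) u0.

Definition Omega (U : finType) (u0 : U) : Type := Z2 -> Alph U u0.

Definition coord_gen (U : finType) (u0 : U) (J : set Z2) : set (set (Omega U u0)) :=
  fun A => exists (v : Z2) (y : U), J v /\ A = [set w : Omega U u0 | w v = y].

Definition OmegaM (U : finType) (u0 : U) := g_sigma_algebraType (coord_gen U u0 setT).

Definition FJ (U : finType) (u0 : U) (J : set Z2) : set (set (OmegaM U u0)) :=
  <<s coord_gen U u0 J >>.

Section Defs.
Variables (R : realType) (U : finType) (u0 : U).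
Local Notation Om := (OmegaM U u0).
Variable (P : probability Om R).

Definition shift (u : Z2) (w : Om) : Om := fun v => w (addZ2 v u).

Definition stationary : Prop :=
  forall (u : Z2) (A : set Om), measurable A -> P (shift u @^-1` A) = P A.

Definition eq_modP (G1 G2 : set (set Om)) : Prop :=
  (forall A, G1 A -> exists B, G2 B /\ P ((A `\` B) `|` (B `\` A)) = 0%E) /\
  (forall B, G2 B -> exists A, G1 A /\ P ((A `\` B) `|` (B `\` A)) = 0%E).

Definition strong_01_law : Prop :=
  forall J : set Z2,
    eq_modP (FJ U u0 J)
      (fun A => forall V : set Z2, finite_set V -> FJ U u0 (J `|` ~` V) A).

(* Condition (B): P(w_0 = y | A) > c0, written multiplied out. *)
Definition condition_B : Prop :=
  exists c0 : R, 0 < c0 /\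
    forall (y : U) (A : set Om), FJ U u0 (~` [set origin]) A -> (0 < P A)%E ->
      (c0%:E * P A < P (A `&` [set w : Om | w origin = y]))%E.

Definition G_measurable (G : set (set Om)) (f : Om -> R) : Prop :=
  forall B : set R, measurable B -> G (f @^-1` B).

Definition is_cond_law (G : set (set Om)) (q : Om -> U -> R) : Prop :=
  forall y : U,
    G_measurable G (fun w => q w y) /\
    P.-integrable setT (fun w => (q w y)%:E) /\
    forall A, G A ->
      (\int[P]_(w in A) (q w y)%:E)%E = P (A `&` [set w : Om | w origin = y]).

(* Shannon entropy H(mu) = - sum_y mu(y) log mu(y)  (ln 0 = 0 in mathcomp) *)
Definition Hent (mu : U -> R) : R := - \sum_(y : U) mu y * ln (mu y).

Definition Lset (lam a : R) (V : set int) : set Z2 :=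
  [set v : Z2 | exists z : int, V z /\ v = (z, Num.floor (lam * z%:~R + a))].

Definition past (lam t : R) : set (set Om) :=
  FJ U u0 (Lset lam t [set z : int | (z < 0)%R]).

(* h_lambda(P) = int_0^1 E_P[ H(P_0[. | P_{lambda,t}]) ] dt, computed with a
   family q of versions of the conditional laws *)
Definition spec_entropy (lam : R) (q : R -> Om -> U -> R) : \bar R :=
  (\int[lebesgue_measure]_(t in `[0%R, 1%R]) \int[P]_w (Hent (q t w))%:E)%E.

Definition cyl (V : set Z2) (w : Om) : set Om :=
  [set eta : Om | forall v, V v -> eta v = w v].

Definition Info (V : set Z2) (w : Om) : R := - ln (fine (P (cyl V w))).

End Defs.

Definition Ln (R : realType) (lam x x' : R) (n : nat) (b : R) : set Z2 :=
  [set v : Z2 | exists z : int,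
     (n%:R * x <= z%:~R <= n%:R * x') /\ v = (z, Num.floor (lam * z%:~R + n%:R * b))].

Definition cardZ2 (R : realType) (V : set Z2) : R := (\sum_(v \in V) (1 : R))%R.

Arguments stationary {R U u0} P.
Arguments eq_modP {R U u0} P G1 G2.
Arguments strong_01_law {R U u0} P.
Arguments condition_B {R U u0} P.
Arguments G_measurable {R U u0} G f.
Arguments is_cond_law {R U u0} P G q.
Arguments Hent {R U} mu.
Arguments Lset {R} lam a V.
Arguments past {R} U u0 lam t.
Arguments spec_entropy {R U u0} P lam q.
Arguments cyl {U u0} V w.
Arguments Info {R U u0} P V w.
Arguments Ln {R} lam x x' n b.

(* Main.v *)
Require Import Defs.
From HB Require Import structures.
From mathcomp Require Import all_boot all_order all_algebra.
From mathcomp Require Import all_classical all_reals all_analysis.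
From mathcomp Require Import measurable_realfun.
From mathcomp Require Import lra ring zify.
Set Implicit Arguments.
Unset Strict Implicit.
Unset Printing Implicit Defensive.
Import Order.TTheory GRing.Theory Num.Theory numFieldNormedType.Exports.
Local Open Scope classical_set_scope.
Local Open Scope ring_scope.

(** Ordering the sites of the segment from left to right, the chain rule writes
    the information of the segment as a sum over sites of shifted conditional
    informations [info W], where [W] is the part of the digital line of slope [lam]
    with intercept [t_k = {lam k + a}] seen so far.  Three facts give the limit.

    Stability: let [C_W] be the conditional mean of a [0,1]-valued [Y] given a finite
    window [W].  By Pythagoras [E C_W^2] increases with [W], and a sequence of nearly
    maximal windows [W_k] inside [J] plus the complement of a growing box is Cauchy;
    the level sets of its limit are tail events over [J], hence [J]-measurable mod P
    by the strong 0-1 law.  So [C_W] hardly depends on [W] once [W] lies between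
    [J] inside a box and [J] plus the complement of that box, and an ultrafilter limit
    makes the box independent of [J].  Condition (B) makes [ln] Lipschitz on the
    relevant range, so conditional informations inherit this stability: the pasts can
    be truncated to length [K], uniformly in the intercept.

    Mixing: the case [J = set0] gives decay of correlations, so the truncated sums
    concentrate around their means.

    Equidistribution: the mean of the truncated information at intercept [t] is a
    function of the signs of [t - theta_j], [theta_j = 1 - {-lam j}].  Each interval
    [0, theta_j) is a bounded remainder set of the rotation by [lam], so the averages
    over [t_k] converge to the integral over [0,1] uniformly in [a]; this covers
    rational and irrational slopes alike. *)

(** * Expectations of bounded measurable functions *)

Section Mean.
Context d (T : measurableType d) (R : realType) (P : probability T R).
Implicit Types f g h : T -> R.

Definition bmeas (f : T -> R) : Prop :=
  measurable_fun [set: T] f /\ exists M : R, forall w, `|f w| <= M.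

Definition Ex (f : T -> R) : R := Rintegral P setT f.

Lemma bmeas_integrable f : bmeas f -> P.-integrable setT (EFin \o f).
Proof.
move=> [mf [M fM]]; apply: measurable_bounded_integrable => //.
- by rewrite (le_lt_trans (probability_le1 P measurableT)) ?ltry.
- exists M; split; first exact: num_real.
  by move=> x Mx w _; exact: le_trans (fM w) (ltW Mx).
Qed.

Lemma bmeas_cst c : bmeas (fun=> c).
Proof. by split; [exact: measurable_cst|exists `|c|]. Qed.

Lemma bmeasD f g : bmeas f -> bmeas g -> bmeas (fun w => f w + g w).
Proof.
move=> [mf [M fM]] [mg [N gN]]; split; first exact: (measurable_funD mf mg).
by exists (M + N) => w; rewrite (le_trans (ler_normD _ _)) ?lerD.
Qed.

Lemma bmeasM f g : bmeas f -> bmeas g -> bmeas (fun w => f w * g w).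
Proof.
move=> [mf [M fM]] [mg [N gN]]; split; first exact: measurable_funM.
by exists (M * N) => w; rewrite normrM ler_pM.
Qed.

Lemma bmeasZ c f : bmeas f -> bmeas (fun w => c * f w).
Proof. by move=> bf; apply: bmeasM => //; exact: bmeas_cst. Qed.

Lemma bmeasN f : bmeas f -> bmeas (fun w => - f w).
Proof.
by move=> [mf [M fM]]; split; [exact: measurable_funN|exists M => w; rewrite normrN].
Qed.

Lemma bmeasB f g : bmeas f -> bmeas g -> bmeas (fun w => f w - g w).
Proof. by move=> bf bg; apply: bmeasD => //; exact: bmeasN. Qed.

Lemma bmeas_norm f : bmeas f -> bmeas (fun w => `|f w|).
Proof.
move=> [mf [M fM]]; split; last by exists M => w; rewrite normr_id.
exact: (measurableT_comp (@normr_measurable R setT)).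
Qed.

Lemma bmeas_sqr f : bmeas f -> bmeas (fun w => f w ^+ 2).
Proof. by move=> bf; under eq_fun do rewrite expr2; exact: bmeasM. Qed.

Lemma bmeas_sum (I : Type) (s : seq I) (F : I -> T -> R) :
  (forall i, bmeas (F i)) -> bmeas (fun w => \sum_(i <- s) F i w).
Proof.
move=> bF; elim: s => [|i s IH].
  by under eq_fun do rewrite big_nil; exact: bmeas_cst.
by under eq_fun do rewrite big_cons; exact: bmeasD.
Qed.

Lemma bmeas_indic (A : set T) : measurable A -> bmeas (\1_A : T -> R).
Proof.
move=> mA; split; first exact: measurable_indic.
by exists 1 => w; rewrite indicE; case: (_ \in _); rewrite ?normr1 ?normr0.
Qed.

End Mean.

(** Descends through sums, products and norms, so that the side conditions of linearity and
    monotonicity of [Ex] close automatically. *)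
Ltac bmt := solve [repeat first [solve [auto 2] | exact: bmeas_cst | exact: bmeas_indic
  | apply: bmeas_sum => ? | apply: bmeasB | apply: bmeasD | apply: bmeasM | apply: bmeasN
  | apply: bmeas_norm | apply: bmeas_sqr]].

Section Expectation.
Context d (T : measurableType d) (R : realType) (P : probability T R).
Implicit Types f g h : T -> R.
Notation Ex := (Ex P).

Lemma ExD f g : bmeas f -> bmeas g -> Ex (fun w => f w + g w) = Ex f + Ex g.
Proof. by move=> bf bg; apply: RintegralD => //; exact: bmeas_integrable. Qed.

Lemma ExB f g : bmeas f -> bmeas g -> Ex (fun w => f w - g w) = Ex f - Ex g.
Proof. by move=> bf bg; apply: RintegralB => //; exact: bmeas_integrable. Qed.

Lemma ExZ c f : bmeas f -> Ex (fun w => c * f w) = c * Ex f.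
Proof. by move=> bf; apply: RintegralZl => //; exact: bmeas_integrable. Qed.

Lemma Ex_cst c : Ex (fun=> c) = c.
Proof. by rewrite /Ex Rintegral_cst//; have /= -> := probability_setT P; rewrite /= mulr1. Qed.

Lemma Ex_sum (I : Type) (s : seq I) (F : I -> T -> R) :
  (forall i, bmeas (F i)) ->
  Ex (fun w => \sum_(i <- s) F i w) = \sum_(i <- s) Ex (F i).
Proof.
move=> bF; elim: s => [|i s IH].
  by under eq_fun do rewrite big_nil; rewrite Ex_cst big_nil.
under eq_fun do rewrite big_cons; rewrite ExD// ?big_cons ?IH//.
exact: bmeas_sum.
Qed.

Lemma Ex_ge0 f : (forall w, 0 <= f w) -> 0 <= Ex f.
Proof. by move=> f0; apply: Rintegral_ge0. Qed.

Lemma ler_Ex f g : bmeas f -> bmeas g -> (forall w, f w <= g w) -> Ex f <= Ex g.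
Proof. by move=> bf bg fg; apply: le_Rintegral => //; exact: bmeas_integrable. Qed.

Lemma Ex_normr f : bmeas f -> `|Ex f| <= Ex (fun w => `|f w|).
Proof. by move=> bf; apply: le_normr_Rintegral => //; exact: bmeas_integrable. Qed.

Lemma EFin_Ex f : bmeas f -> (\int[P]_w (f w)%:E)%E = (Ex f)%:E.
Proof.
by move=> bf; rewrite /Ex /Rintegral fineK//; apply: integrable_fin_num => //;
  exact: bmeas_integrable.
Qed.

Lemma Ex_indic (A : set T) : measurable A -> Ex (\1_A) = fine (P A).
Proof. by move=> mA; rewrite /Ex /Rintegral integral_indic// setIT. Qed.

(** Cauchy-Schwarz against the constant 1: with [m] the mean of [|f|], expand the nonnegative mean
    of [(|f| - m) ^+ 2]. *)
Lemma Ex_cauchy f : bmeas f -> (Ex (fun w => `|f w|)) ^+ 2 <= Ex (fun w => f w ^+ 2).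
Proof.
move=> bf; set m := Ex _.
have b1 : bmeas (fun w => `|f w|) by exact: bmeas_norm.
have b2 : bmeas (fun w => f w ^+ 2) by exact: bmeas_sqr.
have : 0 <= Ex (fun w => (f w ^+ 2 - (2 * m) * `|f w|) + m ^+ 2).
  apply: Ex_ge0 => w; rewrite -[f w ^+ 2]real_normK ?num_real//.
  have := sqr_ge0 (`|f w| - m); lra.
rewrite ExD ?ExB ?ExZ ?Ex_cst -/m; first lra.
all: by rewrite ?/m; bmt.
Qed.

Lemma Ex_le_ub f c : bmeas f -> (forall w, f w <= c) -> Ex f <= c.
Proof. by move=> bf fc; rewrite -(Ex_cst c); apply: ler_Ex => //; exact: bmeas_cst. Qed.

Lemma eq_Ex f g : (forall w, f w = g w) -> Ex f = Ex g.
Proof. by move=> fg; congr Ex; apply/funext. Qed.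

Lemma Ex_norm_le f e : bmeas f -> 0 <= e -> Ex (fun w => f w ^+ 2) <= e ^+ 2 ->
  Ex (fun w => `|f w|) <= e.
Proof.
move=> bf e0 fe; rewrite -(@ler_pXn2r _ 2)// ?nnegrE//; last by apply: Ex_ge0.
exact: le_trans (Ex_cauchy bf) fe.
Qed.

End Expectation.

(** * Local functions and conditional means on finite windows *)

Section Local.
Variables (R : realType) (U : finType) (u0 : U).
Local Notation Om := (OmegaM U u0).

(** An event is a predicate on configurations, so [X := Prop] makes the same notion apply to
    events. *)
Definition local_on (X : Type) (W : set Z2) (f : Om -> X) : Prop :=
  forall w w', (forall v, W v -> w v = w' v) -> f w = f w'.

Lemma loc_sub X W W' (f : Om -> X) : W `<=` W' -> local_on W f -> local_on W' f.
Proof. by move=> WW lf w w' ww; apply: lf => v /WW; exact: ww. Qed.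

Lemma loc_cst X W (c : X) : local_on W (fun=> c).
Proof. by []. Qed.

Lemma loc_comp X Y W (h : X -> Y) (f : Om -> X) : local_on W f -> local_on W (fun w => h (f w)).
Proof. by move=> lf w w' ww; rewrite (lf _ _ ww). Qed.

Lemma loc_comp2 X Y Z W (h : X -> Y -> Z) (f : Om -> X) (g : Om -> Y) :
  local_on W f -> local_on W g -> local_on W (fun w => h (f w) (g w)).
Proof. by move=> lf lg w w' ww; rewrite (lf _ _ ww) (lg _ _ ww). Qed.

Lemma loc_indic W (A : set Om) : local_on W A -> local_on W (\1_A : Om -> R).
Proof.
move=> lA w w' ww; rewrite !indicE; congr (nat_of_bool _)%:R.
by apply/idP/idP; rewrite !inE (lA _ _ ww).
Qed.

Lemma cyl_eq (W : set Z2) (w w' : Om) : (forall v, W v -> w v = w' v) -> cyl W w = cyl W w'.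
Proof.
by move=> ww; apply/seteqP; split => e /= we v Wv; rewrite we// ?ww// -ww.
Qed.

Lemma loc_cyl W (w : Om) : local_on W (cyl W w).
Proof.
move=> e e' ee; apply/propext; rewrite /cyl /=.
by split => h v Wv; rewrite -h// ee.
Qed.

Lemma cylU (W W' : set Z2) (w : Om) : cyl (W `|` W') w = cyl W w `&` cyl W' w.
Proof.
apply/seteqP; split => e /=; first by move=> h; split => v Wv; apply: h; [left|right].
by move=> [h h'] v [] Wv; [exact: h|exact: h'].
Qed.

Lemma cyl0 (w : Om) : cyl set0 w = setT.
Proof. by apply/seteqP; split => // e _ v. Qed.

Lemma FJ_sub (J J' : set Z2) (A : set Om) : J `<=` J' -> FJ U u0 J A -> FJ U u0 J' A.
Proof.
by move=> JJ; apply: sub_sigma_algebra2 => B [v [y [Jv ->]]]; exists v, y; split => //; exact: JJ.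
Qed.

Lemma FJ_measurable (J : set Z2) (A : set Om) : FJ U u0 J A -> measurable A.
Proof. exact: FJ_sub. Qed.

Lemma FJ_coord (J : set Z2) v y : J v -> FJ U u0 J [set w : Om | w v = y].
Proof. by move=> Jv; apply: sub_sigma_algebra; exists v, y. Qed.

(** Turns [FJ J] into the $\sigma$-algebra of a measurable type, which makes the generic closure
    lemmas available for it. *)
Definition OmJ (J : set Z2) := g_sigma_algebraType (coord_gen U u0 J).

Lemma FJ_cyl (W : set Z2) (w : Om) : finite_set W -> FJ U u0 W (cyl W w).
Proof.
move=> fW.
have -> : cyl W w = \bigcap_(v in W) [set e : Om | e v = w v].
  by apply/seteqP; split => e /= h v Wv; exact: h.
by apply: (@fin_bigcap_measurable _ (OmJ W)) => // v Wv; exact: FJ_coord.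
Qed.

(** The patterns are tuples indexed by a duplicate-free enumeration of [W]; off [W] the index is out
    of range and the configuration takes the default symbol [u0]. *)
Lemma cylinder_partition (W : set Z2) : finite_set W ->
  exists (I : finType) (c : I -> Om),
    (forall w, exists i, cyl W (c i) w) /\
    (forall i j w, cyl W (c i) w -> cyl W (c j) w -> i = j).
Proof.
move=> /finite_seqP[s0 Ws0].
have [s us Ws] : exists2 s : seq Z2, uniq s & W = [set` s].
  by exists (undup s0); [exact: undup_uniq|rewrite Ws0; apply/seteqP; split => v /=; rewrite mem_undup].
exists ((size s).-tuple U : finType),
  (fun p : (size s).-tuple U => (fun v : Z2 => nth u0 p (index v s)) : Om); split.
  move=> w; exists (map_tuple w (in_tuple s)); rewrite Ws => v /= vs.
  by rewrite (nth_map (0, 0)%R) ?index_mem// nth_index.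
move=> p p' w; rewrite Ws => h h'; apply: val_inj; apply: (@eq_from_nth _ u0).
  by rewrite !size_tuple.
move=> i; rewrite size_tuple => si.
have vs : nth (0, 0)%R s i \in s by exact: mem_nth.
by move: (h _ vs) (h' _ vs); rewrite index_uniq// => -> ->.
Qed.

Lemma loc_FJ (W : set Z2) (A : set Om) : finite_set W -> local_on W A -> FJ U u0 W A.
Proof.
move=> fW lA; have [I [c [ex un]]] := cylinder_partition fW.
have -> : A = \bigcup_(i in [set i | A (c i)]) cyl W (c i).
  apply/seteqP; split => w /=.
    move=> Aw; have [i ciw] := ex w; exists i => //=.
    by rewrite (lA _ w)// => v Wv; rewrite ciw.
  by move=> [i /= Ai ciw]; rewrite (lA _ (c i))// => v Wv; rewrite ciw.
apply: (@fin_bigcup_measurable _ (OmJ W)) => // i _; exact: FJ_cyl.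
Qed.

Lemma measurable_cyl (W : set Z2) (w : Om) : finite_set W -> measurable (cyl W w).
Proof. by move=> fW; apply: FJ_measurable (FJ_cyl w fW). Qed.

(** A local function is constant on each cylinder of the partition. One choice of [I] and [c] serves
    all [f], so identities between local functions reduce to identities between cylinders. *)
Lemma loc_expand (W : set Z2) : finite_set W ->
  exists (I : finType) (c : I -> Om), forall f : Om -> R, local_on W f ->
    forall w, f w = \sum_i f (c i) * \1_(cyl W (c i)) w.
Proof.
move=> fW; have [I [c [ex un]]] := cylinder_partition fW.
exists I, c => f lf w; have [i ciw] := ex w.
rewrite (bigD1 i)//= big1 ?addr0; last first.
  move=> j ji; rewrite indicE memNset ?mulr0// => cjw.
  by move/eqP: ji; apply; exact: (un _ _ w).
rewrite indicE mem_set// mulr1; apply: lf => v Wv; by rewrite ciw.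
Qed.

Lemma loc_bmeas (W : set Z2) (f : Om -> R) : finite_set W -> local_on W f -> bmeas f.
Proof.
move=> fW lf; have [I [c ex]] := loc_expand fW.
have -> : f = (fun w => \sum_i f (c i) * \1_(cyl W (c i)) w).
  by apply/funext => w; exact: ex.
by apply: bmeas_sum => i; apply: bmeasZ; apply: bmeas_indic; exact: measurable_cyl.
Qed.

End Local.

Section CondExp.
Variables (R : realType) (U : finType) (u0 : U) (P : probability (OmegaM U u0) R).
Local Notation Om := (OmegaM U u0).
Local Notation E := (Ex P).
Implicit Types Y f g : Om -> R.

(** The elementary conditional mean of [Y] given the pattern on [W]; division by zero makes it 0 on
    a null cylinder. *)
Definition cmean Y (W : set Z2) (w : Om) : R :=
  E (fun e => Y e * \1_(cyl W w) e) / fine (P (cyl W w)).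

Lemma loc_cmean Y W : local_on W (cmean Y W).
Proof. by move=> w w' ww; rewrite /cmean (cyl_eq ww). Qed.

Lemma cmean_bmeas Y W : finite_set W -> bmeas (cmean Y W).
Proof. by move=> fW; apply: (loc_bmeas fW); exact: loc_cmean. Qed.

Lemma cmean_ge0 Y W w : (forall w, 0 <= Y w) -> 0 <= cmean Y W w.
Proof.
move=> Y0; apply: divr_ge0; last by rewrite fine_ge0.
apply: Ex_ge0 => e.
by rewrite mulr_ge0// indicE.
Qed.

Lemma cmean_le Y W w c : finite_set W -> bmeas Y -> 0 <= c -> (forall w, Y w <= c) ->
  cmean Y W w <= c.
Proof.
move=> fW bY c0 Y1; rewrite /cmean; have mc := measurable_cyl w fW.
have [->|P0] := eqVneq (fine (P (cyl W w))) 0; first by rewrite invr0 mulr0.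
rewrite ler_pdivrMr ?lt_neqAle 1?eq_sym ?P0 ?fine_ge0//.
rewrite -(Ex_indic P mc) -ExZ; last by bmt.
apply: ler_Ex => [||e]; [bmt|bmt|].
by rewrite ler_wpM2r// indicE.
Qed.

(** On a null cylinder the default value is harmless: the right-hand side is at most a bound of [Y]
    times the probability of the cylinder. *)
Lemma cmean_cyl Y W w : finite_set W -> bmeas Y ->
  cmean Y W w * fine (P (cyl W w)) = E (fun e => Y e * \1_(cyl W w) e).
Proof.
move=> fW bY; rewrite /cmean; have mc := measurable_cyl w fW.
have [P0|P0] := eqVneq (fine (P (cyl W w))) 0; last by rewrite divfK.
rewrite P0 mulr0; apply/esym/eqP; rewrite -normr_le0.
have [mY [M YM]] := bY.
apply: (le_trans (Ex_normr _ _)); first by bmt.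
rewrite -(mulr0 M) -P0 -(Ex_indic P mc) -ExZ; last by bmt.
apply: ler_Ex => [||e]; [bmt|bmt|].
rewrite normrM [X in _ * X]ger0_norm; last by rewrite indicE.
by rewrite ler_wpM2r// indicE.
Qed.

Lemma cmean_proj Y W g : finite_set W -> bmeas Y -> local_on W g ->
  E (fun w => cmean Y W w * g w) = E (fun w => Y w * g w).
Proof.
move=> fW bY lg; have [I [c ex]] := @loc_expand R U u0 W fW.
have bc i : bmeas (\1_(cyl W (c i)) : Om -> R) by apply: bmeas_indic; exact: measurable_cyl.
transitivity (E (fun w => \sum_i (cmean Y W (c i) * g (c i)) * \1_(cyl W (c i)) w)).
  apply: eq_Ex => w; rewrite -(ex (fun w => cmean Y W w * g w))//.
  exact: (loc_comp2 (fun a b : R => a * b) (@loc_cmean Y W) lg).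
transitivity (E (fun w => \sum_i g (c i) * (Y w * \1_(cyl W (c i)) w))).
  rewrite !Ex_sum; last 2 first.
  - by move=> i; bmt.
  - by move=> i; bmt.
  apply: eq_bigr => i _; rewrite !ExZ//; last by bmt.
  by rewrite Ex_indic; [rewrite -cmean_cyl//; ring|exact: measurable_cyl].
apply: eq_Ex => w; rewrite [in RHS](ex g)// mulr_sumr.
by apply: eq_bigr => i _; ring.
Qed.

(** The hypothesis says that [f - Y] is orthogonal to all [W]-local functions, so the cross term
    vanishes. In this form the identity covers both conditional means on larger windows and versions
    of conditional laws. *)
Lemma cmean_best Y W f g : finite_set W -> bmeas Y -> bmeas f ->
  (forall h, local_on W h -> E (fun w => f w * h w) = E (fun w => Y w * h w)) ->
  local_on W g ->
  E (fun w => (f w - g w) ^+ 2) =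
  E (fun w => (f w - cmean Y W w) ^+ 2) + E (fun w => (cmean Y W w - g w) ^+ 2).
Proof.
move=> fW bY bf fY lg; have bp := cmean_bmeas Y fW; have bg := loc_bmeas fW lg.
pose h w := cmean Y W w - g w.
have lh : local_on W h by exact: (loc_comp2 (fun a b : R => a - b) (@loc_cmean Y W) lg).
have bh := loc_bmeas fW lh.
have -> : E (fun w => (f w - g w) ^+ 2) = E (fun w => ((f w - cmean Y W w) ^+ 2 +
   (cmean Y W w - g w) ^+ 2) + 2 * (f w * h w - cmean Y W w * h w)).
  by apply: eq_Ex => w; rewrite /h; ring.
rewrite ExD; [|bmt|bmt]; rewrite ExD; [|bmt|bmt]; rewrite ExZ; last by bmt.
rewrite ExB; [|bmt|bmt]; rewrite fY// cmean_proj//; ring.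
Qed.

Lemma cmean_tower Y W W' h : finite_set W' -> W `<=` W' -> bmeas Y -> local_on W h ->
  E (fun w => cmean Y W' w * h w) = E (fun w => Y w * h w).
Proof. by move=> fW' WW bY lh; apply: cmean_proj => //; exact: loc_sub lh. Qed.

Lemma cmean_pythagoras Y W W' : finite_set W' -> W `<=` W' -> bmeas Y ->
  E (fun w => (cmean Y W' w - cmean Y W w) ^+ 2) =
  E (fun w => cmean Y W' w ^+ 2) - E (fun w => cmean Y W w ^+ 2).
Proof.
move=> fW' WW bY; have fW : finite_set W by exact: sub_finite_set fW'.
have := @cmean_best Y W (cmean Y W') (fun=> 0) fW bY (cmean_bmeas Y fW')
  (fun h => @cmean_tower Y W W' h fW' WW bY) (loc_cst _).
under [X in X = _ -> _]eq_Ex do rewrite subr0.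
under [X in _ = _ + X -> _]eq_Ex do rewrite subr0.
by move=> ->; rewrite addrK.
Qed.

End CondExp.

(** * Approximation by local functions *)

Lemma ge0_sum_indic_le (R : realType) (z : R) n : 0 <= z ->
  \sum_(i < n) (i.+1%:R <= z :> R)%:R <= z :> R.
Proof.
move=> z0; elim: n => [|n IH]; first by rewrite big_ord0.
rewrite big_ord_recr/=; case: (leP n.+1%:R z) => [nz|_]; last by rewrite addr0.
apply: le_trans nz; rewrite -natr1 lerD2r.
apply: (@le_trans _ _ (\sum_(i < n) 1)).
  by apply: ler_sum => i _; rewrite -[leRHS]/(1%:R) ler_nat leq_b1.
by rewrite sumr_const card_ord.
Qed.

Lemma sum_indic_gt (R : realType) (z : R) n :
  Num.min n%:R (z - 1) <= \sum_(i < n) (i.+1%:R < z :> R)%:R :> R.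
Proof.
elim: n => [|n IH]; first by rewrite big_ord0 ge_min lexx.
rewrite big_ord_recr/=; case: (ltP n.+1%:R z) => [nz|zn].
  rewrite /= ge_min -natr1; apply/orP; left; rewrite lerD2r.
  apply: le_trans IH; rewrite le_min lexx/=; move: nz; rewrite -natr1; lra.
rewrite /= addr0 (le_trans _ IH)// le_min !ge_min lexx orbT andbT.
by apply/orP; right; move: zn; rewrite -natr1; lra.
Qed.

(* The layer-cake approximation of [x] by thresholds [i/N] stays accurate when
   each threshold is only decided up to an error [d]. *)
Lemma layer_cake (R : realType) (x d : R) (N : nat) (b : nat -> bool) : (0 < N)%N ->
  0 <= x <= 1 -> 0 <= d ->
  (forall i, b i -> i.+1%:R / N%:R <= x + d) ->
  (forall i, ~~ b i -> x <= i.+1%:R / N%:R + d) ->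
  `|x - N%:R^-1 * \sum_(i < N) (b i)%:R| <= N%:R^-1 + d.
Proof.
move=> N0 /andP[x0 x1] d0 h1 h2.
have N0' : 0 < N%:R :> R by rewrite ltr0n.
have ub : \sum_(i < N) (b i)%:R <= N%:R * (x + d) :> R.
  apply: le_trans (@ge0_sum_indic_le R (N%:R * (x + d)) N _); last first.
    by rewrite mulr_ge0// addr_ge0.
  apply: ler_sum => i _; have := h1 i; case: (b i) => // /(_ isT).
  by rewrite ler_pdivrMr// mulrC => ->.
have lb : N%:R * (x - d) - 1 <= \sum_(i < N) (b i)%:R :> R.
  apply: (@le_trans _ _ (\sum_(i < N) (i.+1%:R < N%:R * (x - d) :> R)%:R)).
    apply: le_trans (sum_indic_gt _ _); rewrite le_min lexx andbT.
    have : N%:R * (x - d) <= N%:R * 1 :> R by rewrite ler_pM2l//; lra.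
    by rewrite mulr1; lra.
  apply: ler_sum => i _; have := h2 i; case: (b i) => [_|/(_ isT)].
    by case: (_ < _).
  rewrite -lerBlDr => hx; rewrite ltNge mulrC -ler_pdivlMr// hx//.
have e1 : N%:R^-1 * (N%:R * (x + d)) = x + d by rewrite mulKf// gt_eqF.
have e2 : N%:R^-1 * (N%:R * (x - d) - 1) = x - d - N%:R^-1.
  by rewrite mulrBr mulKf ?gt_eqF// mulr1.
have Ni : 0 < N%:R^-1 :> R by rewrite invr_gt0.
have ub' : N%:R^-1 * \sum_(i < N) (b i)%:R <= x + d :> R.
  by rewrite -e1 ler_pM2l.
have lb' : x - d - N%:R^-1 <= N%:R^-1 * \sum_(i < N) (b i)%:R :> R.
  by rewrite -e2 ler_pM2l.
by rewrite ler_norml; apply/andP; split; lra.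
Qed.

Section Approximation.
Variables (R : realType) (U : finType) (u0 : U) (P : probability (OmegaM U u0) R).
Local Notation Om := (OmegaM U u0).
Local Notation E := (Ex P).
Implicit Types (J W : set Z2) (A B C : set Om).

(** The probability of the symmetric difference, written as an $L^1$ distance of indicators to have
    the triangle inequality at hand. *)
Definition gap A B : R := E (fun w => `|\1_A w - \1_B w|).

Lemma gap_trans A B C : measurable A -> measurable B -> measurable C ->
  gap A C <= gap A B + gap B C.
Proof.
move=> mA mB mC; rewrite /gap -ExD; [|bmt|bmt]; apply: ler_Ex; [bmt|bmt|].
by move=> w; exact: ler_distD.
Qed.

Lemma gap_setD A B : measurable A -> measurable B -> B `<=` A ->
  gap A B = fine (P A) - fine (P B).
Proof.
move=> mA mB BA; rewrite -!Ex_indic// -ExB; [|bmt|bmt].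
apply: eq_Ex => w; rewrite !indicE.
have [wB|wB] := boolP (w \in B).
  by rewrite mem_set ?subrr ?normr0//; apply: BA; rewrite inE in wB.
by rewrite subr0 normr_nat.
Qed.

Lemma gap_null A B : measurable A -> measurable B ->
  P ((A `\` B) `|` (B `\` A)) = 0%E -> gap A B = 0.
Proof.
move=> mA mB P0.
have mD : measurable ((A `\` B) `|` (B `\` A)) by apply: measurableU; exact: measurableD.
transitivity (fine (P ((A `\` B) `|` (B `\` A)))); last by rewrite P0.
rewrite -Ex_indic//.
apply: eq_Ex => w; rewrite !indicE in_setU !in_setD.
by case: (w \in A); case: (w \in B); rewrite /= ?subrr ?subr0 ?sub0r ?normrN ?normr1 ?normr0.
Qed.

Definition approximable J A : Prop := measurable A /\
  forall e, 0 < e -> exists W C, [/\ finite_set W, W `<=` J, local_on W C & gap A C <= e].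

Lemma loc_measurable W A : finite_set W -> local_on W A -> measurable A.
Proof. by move=> fW lA; apply: FJ_measurable (loc_FJ fW lA). Qed.

Lemma approximable_loc J W A : finite_set W -> W `<=` J -> local_on W A -> approximable J A.
Proof.
move=> fW WJ lA; have mA := loc_measurable fW lA; split=> // e e0.
exists W, A; split => //; rewrite gap_setD// subrr; exact: ltW.
Qed.

Lemma approximable_gap J A B : measurable A -> approximable J B -> gap A B = 0 ->
  approximable J A.
Proof.
move=> mA [mB aB] AB; split=> // e /aB[W [C [fW WJ lC BC]]]; exists W, C; split => //.
apply: le_trans (gap_trans mA mB (loc_measurable fW lC)) _; by rewrite AB add0r.
Qed.

Lemma approximable_setC J A : approximable J A -> approximable J (~` A).
Proof.
move=> [mA aA]; split; first exact: measurableC.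
move=> e /aA[W [C [fW WJ lC AC]]]; exists W, (~` C); split => //.
  by move=> w w' ww; rewrite /setC/= (lC _ _ ww).
apply: le_trans AC; rewrite le_eqVlt; apply/orP; left; apply/eqP.
apply: eq_Ex => w; rewrite !indicE !in_setC.
by case: (w \in A); case: (w \in C); rewrite /= ?subrr ?subr0 ?sub0r ?normrN.
Qed.

Lemma approximable_setU J A B : approximable J A -> approximable J B ->
  approximable J (A `|` B).
Proof.
move=> [mA aA] [mB aB]; split; first exact: measurableU.
move=> e e0; have e20 : 0 < e / 2 by lra.
have [W [C [fW WJ lC AC]]] := aA _ e20; have [W' [C' [fW' WJ' lC' AC']]] := aB _ e20.
have mC := loc_measurable fW lC; have mC' := loc_measurable fW' lC'.
exists (W `|` W'), (C `|` C'); split.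
- by rewrite finite_setU.
- by rewrite subUset.
- move=> w w' ww; rewrite /setU/= (lC w w') ?(lC' w w')// => v Wv; apply: ww; by [left|right].
have -> : e = e / 2 + e / 2 by lra.
apply: le_trans (lerD AC AC'); rewrite /gap -ExD; [|bmt|bmt].
have mU := measurableU _ _ mA mB; have mU' := measurableU _ _ mC mC'.
apply: ler_Ex; [bmt|bmt|] => w; rewrite !indicE !in_setU.
by case: (w \in A); case: (w \in B); case: (w \in C); case: (w \in C');
  rewrite /= ?subrr ?subr0 ?sub0r ?normrN ?normr1 ?normr0 ?addr0 ?add0r//; lra.
Qed.

(** By continuity from below a finite union [G n] misses at most [e / 2] of the mass, and finite
    unions are already known to be approximable. *)
Lemma approximable_bigcup J (F : nat -> set Om) :
  (forall i, approximable J (F i)) -> approximable J (\bigcup_i F i).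
Proof.
move=> aF.
pose G n := \big[setU/set0]_(i < n) F i.
have aG n : approximable J (G n).
  rewrite /G; elim: n => [|n IH]; first by rewrite big_ord0; exact: (@approximable_loc _ set0).
  by rewrite big_ord_recr; exact: approximable_setU.
have mF : measurable (\bigcup_i F i) by apply: bigcupT_measurable => i; case: (aF i).
split=> // e e0.
have cv : (fine \o (P \o G)) @ \oo --> fine (P (\bigcup_i F i)).
  apply: fine_cvg; rewrite fineK ?fin_num_measure//.
  rewrite (_ : \bigcup_i F i = \bigcup_i G i); last first.
    apply/seteqP; split => w.
      move=> [i _ Fi]; exists i.+1 => //; rewrite /G big_ord_recr; by right.
    by move=> [n _ Gn]; apply: (@bigsetU_bigcup _ F n).
  apply: nondecreasing_cvg_mu => [n| |].
  - by case: (aG n).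
  - by apply: bigcupT_measurable => n; case: (aG n).
  by apply/nondecreasing_seqP => n; rewrite subsetEset /G big_ord_recr; exact: subsetUl.
have e20 : 0 < e / 2 by lra.
have [n _ hn] : \forall n \near \oo, `|fine (P (\bigcup_i F i)) - fine (P (G n))| < e / 2.
  by move/cvgrPdist_lt : cv; exact.
have [mG /(_ _ e20)[W [C [fW WJ lC GC]]]] := aG n.
exists W, C; split => //; have mC := loc_measurable fW lC.
apply: (le_trans (gap_trans mF mG mC)).
have -> : e = e / 2 + e / 2 by lra.
apply: lerD GC; rewrite gap_setD//.
  exact: le_trans (ler_norm _) (ltW (hn n (leqnn n))).
by rewrite /G; exact: bigsetU_bigcup.
Qed.

(** The approximable events form a $\sigma$-algebra that contains the coordinate events of [J]. *)
Lemma FJ_approximable J A : FJ U u0 J A -> approximable J A.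
Proof.
move: A; apply: smallest_sub; last first.
  move=> A [v [y [Jv ->]]]; apply: (@approximable_loc _ [set v]) => //.
    by move=> _ ->.
  by move=> w w' ww; rewrite /= ww.
split.
- by apply: (@approximable_loc _ set0).
- by move=> A aA; rewrite setTD; exact: approximable_setC.
- by move=> F aF; exact: approximable_bigcup.
Qed.

(** Replace each layer by an event of a finite window within [e]; averaging the layers averages the
    errors, so the total stays below [e]. *)
Lemma layers_approx J (N : nat) (A : nat -> set Om) e : (0 < N)%N -> 0 < e ->
  (forall i, approximable J (A i)) ->
  exists W (h : Om -> R), [/\ finite_set W, W `<=` J, local_on W h,
    (forall w, 0 <= h w <= 1) &
    E (fun w => `|N%:R^-1 * \sum_(i < N) \1_(A i) w - h w|) <= e].
Proof.
move=> N0 e0 aA.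
have /choice[WC hWC] : forall i, exists WC : set Z2 * set Om,
    [/\ finite_set WC.1, WC.1 `<=` J, local_on WC.1 WC.2 & gap (A i) WC.2 <= e].
  by move=> i; have [_ /(_ _ e0)[W [C hC]]] := aA i; exists (W, C).
have mA i : measurable (A i) by case: (aA i).
have mC i : measurable (WC i).2.
  by have [fW _ lC _] := hWC i; exact: loc_measurable fW lC.
have N0' : 0 < N%:R :> R by rewrite ltr0n.
exists (\bigcup_(i in `I_N) (WC i).1), (fun w => N%:R^-1 * \sum_(i < N) \1_((WC i).2) w); split.
- by apply: bigcup_finite => // i _; case: (hWC i).
- by apply: bigcup_sub => i _; case: (hWC i).
- move=> w w' ww; congr (_ * _); apply: eq_bigr => i _.
  have [_ _ lC _] := hWC i; apply: (loc_indic R lC) => v Wv; apply: ww.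
  by exists i => /=.
- move=> w; apply/andP; split.
    by rewrite mulr_ge0 ?invr_ge0// sumr_ge0// => i _; rewrite indicE.
  rewrite mulrC ler_pdivrMr// mul1r.
  apply: (@le_trans _ _ (\sum_(i < N) 1)).
    by apply: ler_sum => i _; rewrite indicE; case: (_ \in _).
  by rewrite sumr_const card_ord.
apply: (@le_trans _ _ (E (fun w => N%:R^-1 * \sum_(i < N) `|\1_(A i) w - \1_((WC i).2) w|))).
  apply: ler_Ex; [bmt|bmt|] => w.
  rewrite -mulrBr -sumrB normrM ger0_norm ?invr_ge0// ler_wpM2l ?invr_ge0//.
  exact: ler_norm_sum.
rewrite ExZ; last by bmt.
rewrite Ex_sum; last by move=> i; bmt.
rewrite mulrC ler_pdivrMr//.
apply: (@le_trans _ _ (\sum_(i < N) e)); last by rewrite sumr_const card_ord mulr_natr.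
by apply: ler_sum => i _; case: (hWC i).
Qed.

End Approximation.

(** * Stability of conditional means under the strong 0-1 law *)

(** Occurring infinitely often ignores any initial segment, so measurability is required only from
    [n0] on. Applied to smaller and smaller $\sigma$-algebras, this exhibits tail events. *)
Lemma io_measurable d (T : measurableType d) (B : nat -> set T) n0 :
  (forall k, (n0 <= k)%N -> measurable (B k)) ->
  measurable [set w | forall m, exists2 k, (m <= k)%N & B k w].
Proof.
move=> mB.
have -> : [set w | forall m, exists2 k, (m <= k)%N & B k w] =
    \bigcap_m \bigcup_k (B (n0 + m + k)%N).
  apply/seteqP; split => w /= h.
    move=> m _; have [k mk Bk] := h (n0 + m)%N.
    by exists (k - (n0 + m))%N => //; rewrite subnKC.
  move=> m; have [k _ Bk] := h m I; exists (n0 + m + k)%N => //; lia.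
apply: bigcapT_measurable => m; apply: bigcupT_measurable => k.
by apply: mB; lia.
Qed.

Section CauchyLayers.
Context d (T : measurableType d) (R : realType) (P : probability T R).
Local Notation E := (Ex P).

(* The layer sets of [limsup f] are events of the form "infinitely often", so they
   are insensitive to any initial segment of the sequence. *)
Lemma cauchy_layers (f : nat -> T -> R) (K N : nat) (c : R) : (0 < N)%N ->
  (forall k, bmeas (f k)) -> (forall k w, 0 <= f k w <= 1) ->
  (forall n, \sum_(0 <= i < n) E (fun w => `|f (K + i).+1 w - f (K + i)%N w|) <= c) ->
  E (fun w => `|f K w - N%:R^-1 * \sum_(i < N)
     \1_[set w | forall m, exists2 k, (m <= k)%N & i.+1%:R / N%:R < f k w] w|)
  <= N%:R^-1 + c.
Proof.
move=> N0 bf f01 sc.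
pose A (i : nat) := [set w | forall m, exists2 k, (m <= k)%N & i.+1%:R / N%:R < f k w].
have mA i : measurable (A i).
  apply: (@io_measurable _ _ (fun k => [set w | i.+1%:R / N%:R < f k w]) 0) => k _.
  rewrite -[X in measurable X]setTI; have [mf _] := bf k.
  by apply: (measurable_fun_ltr (measurable_cst _) mf) => //; exact: measurable_set1.
pose g w := N%:R^-1 * \sum_(i < N) \1_(A i) w : R.
rewrite -/(g _) -[X in E X]/(fun w => `|f K w - g w|).
have bg : bmeas g by rewrite /g; bmt.
pose D (i : nat) (w : T) : R := `|f (K + i).+1 w - f (K + i)%N w|.
have bD i : bmeas (D i) by rewrite /D; bmt.
have D0 i w : (0 <= (D i w)%:E)%E by rewrite lee_fin normr_ge0.
(* If the increments from [K] on have finite sum [s], every later value is within [s] of [f K w], so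
   each threshold is decided up to [s] and [layer_cake] applies. An infinite sum makes the bound
   trivial. *)
have pw w : ((`|f K w - g w|)%:E <= (N%:R^-1)%:E + \sum_(i <oo) (D i w)%:E)%E.
  have S0 : (0 <= \sum_(i <oo) (D i w)%:E)%E by apply: nneseries_ge0 => n _ _.
  case ES : (\sum_(i <oo) (D i w)%:E)%E S0 => [s||]// S0; last by rewrite addey ?leey.
  rewrite lee_fin in S0.
  have fd j : `|f (K + j)%N w - f K w| <= s.
    apply: (@le_trans _ _ (\sum_(0 <= i < j) D i w)).
      elim: j => [|j IH]; first by rewrite addn0 subrr normr0 big_nil.
      rewrite big_nat_recr//= addnS.
      apply: (le_trans (ler_distD (f (K + j)%N w) _ _)); rewrite addrC lerD//.
    rewrite -lee_fin -ES -sumEFin.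
    by apply: (@nneseries_lim_ge R (fun i => (D i w)%:E) xpredT 0 j) => n _ _.
  rewrite -EFinD lee_fin /g.
  under eq_bigr do rewrite indicE.
  apply: (@layer_cake R (f K w) s N (fun i => w \in A i)) => // i.
    rewrite inE => /(_ K)[k Kk hk]; apply: (le_trans (ltW hk)).
    have := fd (k - K)%N; rewrite subnKC// => /(le_trans (ler_norm _)); lra.
  rewrite notin_setE => /existsNP[m hm].
  have hk : f (K + m)%N w <= i.+1%:R / N%:R.
    by rewrite leNgt; apply/negP => hk; apply: hm; exists (K + m)%N => //; lia.
  have := fd m; rewrite distrC => /(le_trans (ler_norm _)); lra.
have mD i : measurable_fun setT (fun w => (D i w)%:E).
  by apply/measurable_EFinP; case: (bD i).
rewrite -lee_fin -EFin_Ex; last by bmt.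
apply: (@le_trans _ _ (\int[P]_w ((N%:R^-1)%:E + \sum_(i <oo) (D i w)%:E))%E).
  apply: ge0_le_integral => //.
  - by apply/measurable_EFinP; apply: (bmeas_norm (bmeasB (bf K) bg)).1.
  - apply: emeasurable_funD => //.
    by apply: ge0_emeasurable_sum.
rewrite ge0_integralD//; last 2 first.
- by move=> w _; apply: nneseries_ge0.
- by apply: ge0_emeasurable_sum.
rewrite integral_cst//; have /= -> := probability_setT P.
rewrite mule1 EFinD leeD2l// integral_nneseries//.
under eq_eseriesr do rewrite EFin_Ex//.
apply: lime_le.
  by apply: is_cvg_nneseries => n _ _; rewrite lee_fin; apply: Ex_ge0 => w; exact: normr_ge0.
by apply: nearW => n; rewrite sumEFin lee_fin.
Qed.

End CauchyLayers.

(** An exhaustion of the plane by finite sets taken from an enumeration of the sites: only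
    finiteness, monotonicity and exhaustion matter, not the shape. *)
Definition box (n : nat) : set Z2 := [set v : Z2 | (pickle (v : int * int) < n)%N].

Lemma finite_box n : finite_set (box n).
Proof.
apply: (@sub_finite_set _ _ ((fun i => odflt (0, 0) (unpickle i)) @` `I_n)); last first.
  by apply: finite_image; exact: finite_II.
by move=> v /= vn; exists (pickle (v : int * int)) => //; rewrite pickleK.
Qed.

Lemma box_mono m n : (m <= n)%N -> box m `<=` box n.
Proof. by move=> mn v /= vm; exact: leq_trans mn. Qed.

Lemma finite_sub_box (W : set Z2) : finite_set W -> exists n, W `<=` box n.
Proof.
move=> /finite_seqP[s ->].
exists (\max_(v <- s) pickle (v : int * int)).+1 => v /= vs.
by rewrite /box/= ltnS (big_rem _ vs)/= leq_maxl.
Qed.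

Section Strong.
Variables (R : realType) (U : finType) (u0 : U) (P : probability (OmegaM U u0) R).
Local Notation Om := (OmegaM U u0).
Local Notation E := (Ex P).
Variable Y : Om -> R.
Hypothesis bY : bmeas Y.
Hypothesis Y01 : forall w, 0 <= Y w <= 1.
Implicit Types (J W V : set Z2).

Definition energy W : R := E (fun w => cmean P Y W w ^+ 2).

Lemma cmean01 W w : finite_set W -> 0 <= cmean P Y W w <= 1.
Proof.
move=> fW; apply/andP; split.
  by apply: cmean_ge0 => e; case/andP: (Y01 e).
by apply: cmean_le => // e; case/andP: (Y01 e).
Qed.

Lemma energy_dist W W' : finite_set W' -> W `<=` W' ->
  E (fun w => (cmean P Y W' w - cmean P Y W w) ^+ 2) = energy W' - energy W.
Proof. by move=> fW' WW; exact: cmean_pythagoras. Qed.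

Lemma energy_mono W W' : finite_set W' -> W `<=` W' -> energy W <= energy W'.
Proof.
move=> fW' WW; rewrite -subr_ge0 -energy_dist//; apply: Ex_ge0 => w; exact: sqr_ge0.
Qed.

Lemma energy_ge0 W : 0 <= energy W.
Proof. by apply: Ex_ge0 => w; exact: sqr_ge0. Qed.

Lemma energy_le1 W : finite_set W -> energy W <= 1.
Proof.
move=> fW; apply: Ex_le_ub => [|w]; first by apply: bmeas_sqr; exact: cmean_bmeas.
by have /andP[? ?] := cmean01 w fW; rewrite expr2 mulr_ile1.
Qed.

Lemma sqr_le_norm (a b : R) : 0 <= a <= 1 -> 0 <= b <= 1 -> (a - b) ^+ 2 <= `|a - b|.
Proof.
move=> /andP[a0 a1] /andP[b0 b1]; rewrite -real_normK ?num_real// expr2.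
by rewrite -[leRHS]mulr1 ler_wpM2l// ler_norml; apply/andP; split; lra.
Qed.

(** In $L^2$ the conditional mean on [W0] is at least as close to the one on [W] as [h] is, and for
    values in $[0,1]$ the squared error is at most the absolute error. *)
Lemma approx_energy J W0 W h e : finite_set W -> W0 `<=` W -> local_on W0 h ->
  (forall w, 0 <= h w <= 1) -> E (fun w => `|cmean P Y W w - h w|) <= e ->
  energy W - e <= energy W0.
Proof.
move=> fW WW lh h01 he; have fW0 : finite_set W0 by exact: sub_finite_set fW.
have bp := cmean_bmeas P Y fW; have bp0 := cmean_bmeas P Y fW0; have bh := loc_bmeas fW0 lh.
have := @cmean_best _ _ _ P Y W0 (cmean P Y W) h fW0 bY bp
  (fun h => @cmean_tower _ _ _ P Y W0 W h fW WW bY) lh.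
rewrite energy_dist// => eq.
have : E (fun w => (cmean P Y W w - h w) ^+ 2) <= e.
  apply: le_trans he; apply: ler_Ex; [bmt|bmt|] => w.
  by apply: sqr_le_norm => //; exact: cmean01.
rewrite eq; have : 0 <= E (fun w => (cmean P Y W0 w - h w) ^+ 2).
  by apply: Ex_ge0 => w; exact: sqr_ge0.
lra.
Qed.

Definition upper_energies J n := [set x | exists W, [/\ finite_set W,
  W `<=` J `|` ~` box n & x = energy W]].
Definition upper_energy J n := sup (upper_energies J n).

Lemma has_sup_upper J n : has_sup (upper_energies J n).
Proof.
split; first by exists (energy set0), set0; split.
by exists 1 => _ [W [fW _ ->]]; exact: energy_le1.
Qed.

Lemma upper_energyP J n W : finite_set W -> W `<=` J `|` ~` box n ->
  energy W <= upper_energy J n.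
Proof.
by move=> fW WJ; apply: ub_le_sup; [case: (has_sup_upper J n)|exists W].
Qed.

Lemma upper_energy_mono J m n : (m <= n)%N -> upper_energy J n <= upper_energy J m.
Proof.
move=> mn; apply: ge_sup; first by case: (has_sup_upper J n).
move=> _ [W [fW WJ ->]]; apply: upper_energyP => //.
apply: (subset_trans WJ); apply: setUS; apply: subsetC; exact: box_mono.
Qed.

(** The limit of the decreasing sequence of upper energies. It stands for the squared norm of the
    conditional mean of [Y] given the intersection of the $\sigma$-algebras over [J] and the
    complements of finite boxes. *)
Definition tail_energy J := inf (range (upper_energy J)).

Lemma has_inf_upper J : has_inf (range (upper_energy J)).
Proof.
split; first by exists (upper_energy J 0), 0%N.
exists 0 => _ [n _ <-]; apply: le_trans (energy_ge0 set0) _.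
exact: upper_energyP.
Qed.

Lemma tail_energy_le J n : tail_energy J <= upper_energy J n.
Proof. by apply: ge_inf; [case: (has_inf_upper J)|exists n]. Qed.

(** Energies within $4^{-k}$ of the limit will give $L^1$ increments of order $2^{-k}$, which are
    summable. *)
Lemma tail_sequence J : exists (m : nat -> nat) (W : nat -> set Z2),
  [/\ {homo m : i j / (i <= j)%N}, (forall k, (k <= m k)%N),
      (forall k, upper_energy J (m k) <= tail_energy J + 4%:R^-1 ^+ k) &
      forall k, [/\ finite_set (W k), J `&` box (m k) `<=` W k,
        W k `<=` J `|` ~` box (m k) & tail_energy J - 4%:R^-1 ^+ k <= energy (W k)]].
Proof.
have p4 k : 0 < 4%:R^-1 ^+ k :> R by rewrite exprn_gt0// invr_gt0.
have /choice[m0 hm0] : forall k, exists n, upper_energy J n <= tail_energy J + 4%:R^-1 ^+ k.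
  move=> k; have [_ [n _ <-] hn] := inf_adherent (p4 k) (has_inf_upper J).
  by exists n; exact: ltW.
(* Partial sums make [m] increasing, and at least as large as both [k] and [m0 k]. *)
pose m k := (\sum_(i < k.+1) (m0 i).+1)%N.
have mS k : m k.+1 = (m k + (m0 k.+1).+1)%N by rewrite /m big_ord_recr.
have mge k : (k <= m k)%N && (m0 k <= m k)%N.
  elim: k => [|k IH]; first by rewrite /m big_ord_recr big_ord0/=; lia.
  by rewrite mS; lia.
have /choice[W hW] : forall k, exists W, [/\ finite_set W, J `&` box (m k) `<=` W,
        W `<=` J `|` ~` box (m k) & tail_energy J - 4%:R^-1 ^+ k <= energy W].
  move=> k; have [_ [W [fW WJ ->]] hW] := sup_adherent (p4 k) (has_sup_upper J (m k)).
  have fJ : finite_set (J `&` box (m k)) by apply: finite_setIr; exact: finite_box.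
  have fU : finite_set (W `|` (J `&` box (m k))) by rewrite finite_setU.
  (* Adding the part of [J] in the box respects the constraint on the window and can only raise the
     energy. *)
  exists (W `|` (J `&` box (m k))); split => //.
    by rewrite subUset; split => // v [Jv _]; left.
  apply: le_trans (energy_mono fU (@subsetUl _ _ _)); apply: le_trans (ltW hW).
  by rewrite lerD2r; exact: tail_energy_le.
exists m, W; split => //.
- apply: homo_leq => // [a b c|i]; first exact: leq_trans.
  by rewrite mS leq_addr.
- by move=> k; case/andP: (mge k).
move=> k; apply: le_trans (hm0 k); apply: upper_energy_mono; by case/andP: (mge k).
Qed.

(** Both windows nearly exhaust the energy of their union, so by Pythagoras both conditional means
    are close to that of the union. *)
Lemma dist_union W W' s a b : finite_set W -> finite_set W' ->
  energy (W `|` W') <= s -> s - a <= energy W -> s - b <= energy W' ->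
  E (fun w => (cmean P Y W' w - cmean P Y W w) ^+ 2) <= 2 * (a + b).
Proof.
move=> fW fW' es ea eb; have fU : finite_set (W `|` W') by rewrite finite_setU.
have bp := cmean_bmeas P Y fW; have bp' := cmean_bmeas P Y fW'; have bu := cmean_bmeas P Y fU.
have d1 := energy_dist fU (@subsetUl _ W W').
have d2 := energy_dist fU (@subsetUr _ W W').
apply: (@le_trans _ _ (E (fun w =>
   2 * ((cmean P Y (W `|` W') w - cmean P Y W w) ^+ 2 + (cmean P Y (W `|` W') w - cmean P Y W' w) ^+ 2)))).
  apply: ler_Ex; [bmt|bmt|] => w.
  set x := cmean P Y (W `|` W') w; set y := cmean P Y W w; set z := cmean P Y W' w.
  by have := sqr_ge0 (2 * x - y - z); lra.
by rewrite ExZ ?ExD ?d1 ?d2; [lra|bmt|bmt|bmt].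
Qed.

Hypothesis H01 : strong_01_law P.

(** The strong 0-1 law enters here. Nearly maximal windows give an $L^1$-Cauchy sequence; the layers
    of its limsup are tail events over [J], hence events of [J] up to null sets, hence close to
    events of a finite window [W0] inside [J]. By best approximation [W0] then carries almost all
    the energy. *)
Lemma tail_energy_approx J e : 0 < e ->
  exists W, [/\ finite_set W, W `<=` J & tail_energy J - e <= energy W].
Proof.
move=> e0; have [m [W [mh mk hm hW]]] := tail_sequence J.
have fW k : finite_set (W k) by case: (hW k).
pose f k := cmean P Y (W k).
have bf k : bmeas (f k) by exact: cmean_bmeas.
have f01 k w : 0 <= f k w <= 1 by exact: cmean01.
have p4 k : 0 < 4%:R^-1 ^+ k :> R by rewrite exprn_gt0// invr_gt0.
have p2 k : 0 < 2%:R^-1 ^+ k :> R by rewrite exprn_gt0// invr_gt0.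
have p42 k : 4%:R^-1 ^+ k = (2%:R^-1 ^+ k) ^+ 2 :> R.
  by rewrite -exprM mulnC exprM; congr (_ ^+ _); rewrite expr2 -invfM -natrM.
(* With $s$ the tail energy plus $4^{-k}$, the two windows fall short of $s$ by at most $2$ and
   $5/4$ times $4^{-k}$; twice the sum of these is below $9\cdot 4^{-k} = (3\cdot 2^{-k})^2$. *)
have step k : E (fun w => `|f k.+1 w - f k w|) <= 3%:R * 2%:R^-1 ^+ k.
  apply: Ex_norm_le; [bmt|by have := p2 k; lra|].
  have [_ _ W1 e1] := hW k; have [_ _ W2 e2] := hW k.+1.
  have WU : W k `|` W k.+1 `<=` J `|` ~` box (m k).
    rewrite subUset; split => //; apply: (subset_trans W2); apply: setUS; apply: subsetC.
    by apply: box_mono; exact: mh.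
  have fU : finite_set (W k `|` W k.+1) by rewrite finite_setU.
  have eU := le_trans (upper_energyP fU WU) (hm k).
  apply: (le_trans (@dist_union (W k) (W k.+1) _ (2 * 4%:R^-1 ^+ k) (5%:R / 4%:R * 4%:R^-1 ^+ k)
     (fW _) (fW _) eU _ _)).
  - by move: e1; lra.
  - by move: e2; rewrite exprS; lra.
  by rewrite exprMn -p42; have := p4 k; lra.
have sumbd K n : \sum_(0 <= i < n) E (fun w => `|f (K + i).+1 w - f (K + i)%N w|)
    <= 6%:R * 2%:R^-1 ^+ K.
  (* The sharper bound, with the remaining geometric tail subtracted, is the one that passes through
     the induction. *)
  suff : \sum_(0 <= i < n) E (fun w => `|f (K + i).+1 w - f (K + i)%N w|)
    <= 6%:R * 2%:R^-1 ^+ K - 6%:R * 2%:R^-1 ^+ (K + n).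
    by have := p2 (K + n)%N; lra.
  elim: n => [|n IH]; first by rewrite big_nil addn0 subrr.
  rewrite big_nat_recr//= addnS exprS; have := step (K + n)%N; lra.
pose N := (Num.truncn (8%:R / e)).+1.
have N0 : (0 < N)%N by [].
have Ne : N%:R^-1 <= e / 8%:R.
  rewrite -[leRHS]invrK lef_pV2 ?posrE ?invr_gt0 ?divr_gt0 ?ltr0n// invf_div.
  by apply: ltW; rewrite /N truncnS_gt.
pose A (i : nat) : set Om := [set w | forall n, exists2 k, (n <= k)%N & i.+1%:R / N%:R < f k w].
have aA i : approximable P J (A i).
  (* From some [n] on the windows avoid [V] outside [J], and [A i] depends only on those terms. *)
  have tA V : finite_set V -> FJ U u0 (J `|` ~` V) (A i).
    move=> /finite_sub_box[n Vn].
    apply: (@io_measurable _ (OmJ u0 (J `|` ~` V)) (fun k => [set w | i.+1%:R / N%:R < f k w]) n) => k nk.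
    apply: (@FJ_sub _ _ (W k)).
      have [_ _ Wk _] := hW k; apply: (subset_trans Wk); apply: setUS; apply: subsetC.
      by apply: (subset_trans Vn); apply: box_mono; apply: (leq_trans nk).
    apply: loc_FJ => // w w' ww /=; congr (is_true (_ < _)); exact: (@loc_cmean _ _ _ P Y (W k)).
  have [B [FB PB]] := (H01 J).2 (A i) tA.
  have aB := FJ_approximable P FB.
  have mA : measurable (A i) by apply: (FJ_measurable (tA set0 _)).
  apply: (approximable_gap mA aB); apply: gap_null => //; first by case: aB.
  by rewrite setUC.
have e8 : 0 < e / 8%:R by lra.
have [W0 [h [fW0 WJ lh h01 hE]]] := layers_approx N0 e8 aA.
have [n0 Wn0] := finite_sub_box fW0.
have [K0 hK0] : exists K, 2%:R^-1 ^+ K <= e / 64%:R.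
  have e64 : 0 < e / 64%:R by lra.
  have : (2%:R^-1 ^+ k : R) @[k --> \oo] --> 0.
    by apply: cvg_expr; rewrite ger0_norm ?invr_ge0// invf_lt1// ltr1n.
  move/cvgrPdist_le => /(_ _ e64)[K _ /(_ K (leqnn _))].
  by rewrite sub0r normrN ger0_norm; [exists K|exact: ltW].
(* [K0] makes the geometric errors small, and [n0] guarantees that [W K] contains [W0]. *)
pose K := (maxn K0 n0).
have hK : 2%:R^-1 ^+ K <= e / 64%:R.
  apply: le_trans hK0; apply: ler_wiXn2l; rewrite ?invr_ge0// ?invf_le1 ?ler1n//.
  exact: leq_maxl.
have WK : W0 `<=` W K.
  have [_ JW _ _] := hW K; apply: subset_trans JW => v Wv; split; first exact: WJ.
  by apply: (@box_mono n0); [apply: leq_trans (mk K); exact: leq_maxr|exact: Wn0].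
exists W0; split => //.
pose g w := N%:R^-1 * \sum_(i < N) \1_(A i) w : R.
have mA i : measurable (A i) by case: (aA i).
have bg : bmeas g by rewrite /g; bmt.
have bh := loc_bmeas fW0 lh.
have Efg : E (fun w => `|f K w - g w|) <= N%:R^-1 + 6%:R * 2%:R^-1 ^+ K.
  exact: cauchy_layers.
have Efh : E (fun w => `|f K w - h w|) <= e / 2.
  apply: (@le_trans _ _ (E (fun w => `|f K w - g w| + `|g w - h w|))).
    by apply: ler_Ex; [bmt|bmt|] => w; exact: ler_distD.
  rewrite ExD; [|bmt|bmt]; move: hE Efg Ne hK; rewrite -/(g _).
  rewrite -[X in E X <= _]/(fun w => `|g w - h w|); lra.
have := approx_energy J (fW K) WK lh h01 Efh.
have [_ _ _] := hW K.
have : 4%:R^-1 ^+ K <= 2%:R^-1 ^+ K :> R.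
  by apply: lerXn2r; rewrite ?nnegrE ?invr_ge0// lef_pV2 ?posrE// ler_nat.
by lra.
Qed.

(** The squared distance is a difference of energies: the larger one is at most the tail energy plus
    [e / 2], the smaller one at least the tail energy minus [e / 2]. *)
Lemma conditional_stability J e : 0 < e -> exists n, forall W, finite_set W ->
  J `&` box n `<=` W -> W `<=` J `|` ~` box n ->
  E (fun w => (cmean P Y W w - cmean P Y (J `&` box n) w) ^+ 2) <= e.
Proof.
move=> e0; have e20 : 0 < e / 2 by lra.
have [W0 [fW0 WJ hW0]] := tail_energy_approx J e20.
have [_ [n1 _ <-] hn1] := inf_adherent e20 (has_inf_upper J).
have [n2 Wn2] := finite_sub_box fW0.
exists (maxn n1 n2) => W fW JW WJ'; rewrite energy_dist//.
have : energy W <= upper_energy J n1.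
  apply: upper_energyP => //; apply: (subset_trans WJ'); apply: setUS; apply: subsetC.
  by apply: box_mono; exact: leq_maxl.
have : energy W0 <= energy (J `&` box (maxn n1 n2)).
  apply: energy_mono; first by apply: finite_setIr; exact: finite_box.
  move=> v Wv; split; first exact: WJ.
  by apply: (@box_mono n2); [exact: leq_maxr|exact: Wn2].
by move: hn1 hW0; rewrite /tail_energy; lra.
Qed.

(* Compactness of the space of subsets of Z^2, in the form of an ultrafilter
   limit of a sequence of counterexamples. *)
Lemma uniform_conditional_stability e : 0 < e -> exists n, forall J W W',
  finite_set W -> finite_set W' ->
  J `&` box n `<=` W -> W `<=` J `|` ~` box n ->
  J `&` box n `<=` W' -> W' `<=` J `|` ~` box n ->
  E (fun w => (cmean P Y W w - cmean P Y W' w) ^+ 2) <= e.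
Proof.
move=> e0; apply: contrapT => /forallNP bad.
have /choice[J hJ] : forall n, exists J, ~ forall W W',
  finite_set W -> finite_set W' ->
  J `&` box n `<=` W -> W `<=` J `|` ~` box n ->
  J `&` box n `<=` W' -> W' `<=` J `|` ~` box n ->
  E (fun w => (cmean P Y W w - cmean P Y W' w) ^+ 2) <= e.
  by move=> n; have /existsNP := bad n.
have [G [GU sG]] := ultraFilterLemma (@eventually_filter).
pose JG : set Z2 := [set v | G [set n | J n v]].
have e40 : 0 < e / 4 by lra.
have [n hn] := conditional_stability JG e40.
(* On any finite list of sites the limit set [JG] agrees with [J k] for [G]-almost all [k]. *)
have agree s : G [set k | forall v : Z2, v \in (s : seq Z2) -> JG v = J k v].
  elim: s => [|v s IH]; first by apply: filterS filterT.
  have Gv : G [set k | JG v = J k v].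
    have [Gv|Gv] := in_ultra_setVsetC [set n | J n v] GU.
      apply: filterS (Gv) => k /= Jk; apply/propext; split => //.
    have nJ : ~ JG v.
      by move=> h; apply: (@filter_not_empty _ G _); apply: filterS (filterI h Gv) => k [].
    by apply: filterS (Gv) => k /= Jk; apply/propext; split.
  apply: filterS (filterI Gv IH) => k /= [h1 h2] u; rewrite inE => /predU1P[->//|us].
  exact: h2.
have /finite_seqP[s bs] := finite_box n.
have Gn : G [set k | (n <= k)%N] by apply: sG; exists n.
have [k [nk hk]] := filter_ex (filterI Gn (agree s)).
apply: (hJ k) => W W' fW fW' JW WJ JW' WJ'.
have eqb v : box n v -> JG v = J k v by move=> bv; apply: hk; move: bv; rewrite bs.
have bnk := box_mono nk.
(* As [n <= k] and [JG] agrees with [J k] on [box n], a window squeezed at level [k] for [J k] is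
   squeezed at level [n] for [JG]. Both windows are then close to the same reference window. *)
have sand X : J k `&` box k `<=` X -> X `<=` J k `|` ~` box k ->
    (JG `&` box n `<=` X) /\ (X `<=` JG `|` ~` box n).
  move=> h1 h2; split => [v [Jv bv]|v Xv].
    by apply: h1; split; [rewrite -eqb|exact: bnk].
  have [bv|] := pselect (box n v); last by right.
  have [Jv|nb] := h2 _ Xv; [by left; rewrite eqb|by exfalso; apply: nb; exact: bnk].
have [a1 a2] := sand _ JW WJ; have [b1 b2] := sand _ JW' WJ'.
have hW := hn _ fW a1 a2; have hW' := hn _ fW' b1 b2.
have fB : finite_set (JG `&` box n) by apply: finite_setIr; exact: finite_box.
have bp := cmean_bmeas P Y fW; have bp' := cmean_bmeas P Y fW'; have bb := cmean_bmeas P Y fB.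
set B := JG `&` box n in hW hW' fB bb.
apply: (@le_trans _ _ (E (fun w =>
   2 * ((cmean P Y W w - cmean P Y B w) ^+ 2 + (cmean P Y W' w - cmean P Y B w) ^+ 2)))).
  apply: ler_Ex; [bmt|bmt|] => w.
  set x := cmean P Y B w; set y := cmean P Y W w; set z := cmean P Y W' w.
  by have := sqr_ge0 (2 * x - y - z); lra.
by rewrite ExZ ?ExD; [lra|bmt|bmt|bmt].
Qed.

End Strong.

(** * Conditional laws as limits of conditional means on finite windows *)

Section Versions.
Variables (R : realType) (U : finType) (u0 : U) (P : probability (OmegaM U u0) R).
Local Notation Om := (OmegaM U u0).
Local Notation E := (Ex P).

(** The level sets of [f] are events of [J], so [f] is $L^1$-close to a function local in a finite
    part of [J]. Once [W] contains that part, the conditional mean is an even better $L^2$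
    approximation. *)
Lemma cmean_converges (Y f : Om -> R) (J : set Z2) e : bmeas Y -> bmeas f ->
  (forall w, 0 <= f w <= 1) ->
  (forall c, FJ U u0 J [set w | c <= f w]) ->
  (forall W h, finite_set W -> W `<=` J -> local_on W h ->
     E (fun w => f w * h w) = E (fun w => Y w * h w)) -> 0 < e ->
  exists n, forall W, finite_set W -> J `&` box n `<=` W -> W `<=` J ->
    E (fun w => (f w - cmean P Y W w) ^+ 2) <= e.
Proof.
move=> bY bf f01 lf fY e0.
pose N := (Num.truncn (2%:R / e)).+1.
have N0 : (0 < N)%N by [].
have Ne : N%:R^-1 <= e / 2%:R.
  rewrite -[leRHS]invrK lef_pV2 ?posrE ?invr_gt0 ?divr_gt0 ?ltr0n// invf_div.
  by apply: ltW; rewrite /N truncnS_gt.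
pose A (i : nat) : set Om := [set w | i.+1%:R / N%:R <= f w].
have aA i : approximable P J (A i) by apply: FJ_approximable; exact: lf.
have e20 : 0 < e / 2 by lra.
have [W0 [h [fW0 WJ lh h01 hE]]] := layers_approx N0 e20 aA.
have [n Wn] := finite_sub_box fW0.
exists n => W fW JW WJ'.
have W0W : W0 `<=` W by move=> v Wv; apply: JW; split; [exact: WJ|exact: Wn].
have lhW : local_on W h by exact: loc_sub lh.
have := cmean_best fW bY bf (fun h lh => fY W h fW WJ' lh) lhW.
have : 0 <= E (fun w => (cmean P Y W w - h w) ^+ 2).
  by apply: Ex_ge0 => w; exact: sqr_ge0.
have bh := loc_bmeas fW0 lh; have mA i : measurable (A i) by case: (aA i).
pose g w := N%:R^-1 * \sum_(i < N) \1_(A i) w : R.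
have bg : bmeas g by rewrite /g; bmt.
have fg w : `|f w - g w| <= N%:R^-1.
  rewrite -[leRHS]addr0 /g; under eq_bigr do rewrite indicE.
  apply: (@layer_cake R (f w) 0 N (fun i => w \in A i)) => // i; first by rewrite inE addr0.
  by rewrite notin_setE addr0 /A/= => /negP; rewrite -ltNge => /ltW.
have : E (fun w => (f w - h w) ^+ 2) <= E (fun w => N%:R^-1 + `|g w - h w|).
  apply: ler_Ex; [bmt|bmt|] => w; apply: le_trans (sqr_le_norm (f01 w) (h01 w)) _.
  by apply: (le_trans (ler_distD (g w) _ _)); rewrite lerD2r.
rewrite ExD ?Ex_cst; [|bmt|bmt]; move: hE; rewrite -/(g _).
rewrite -[X in E X <= _]/(fun w => `|g w - h w|); lra.
Qed.

End Versions.

(** * Conditional information and the chain rule *)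

Section LogBounds.
Variable R : realType.
Implicit Types a b c : R.

Lemma ln_lipschitz c a b : 0 < c -> c <= a -> c <= b -> `|ln a - ln b| <= c^-1 * `|a - b|.
Proof.
move=> c0.
suff H x y : c <= x -> c <= y -> ln x - ln y <= c^-1 * `|x - y|.
  by move=> ca cb; rewrite ler_norml lerNl opprB H//= distrC H.
move=> cx cy; have x0 := lt_le_trans c0 cx; have y0 := lt_le_trans c0 cy.
rewrite -ln_div ?posrE//.
have -> : x / y = 1 + (x - y) / y by rewrite mulrBl divff ?gt_eqF//; ring.
apply: le_trans (le_ln1Dx _) _; first by rewrite mulrBl divff ?gt_eqF//; have := divr_gt0 x0 y0; lra.
apply: (@le_trans _ _ (`|x - y| / y)); first by rewrite ler_pM2r ?invr_gt0// ler_norm.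
by rewrite mulrC ler_wpM2r// lef_pV2 ?posrE.
Qed.

(** Write the difference as [b * (ln a - ln b) + ln a * (a - b)]; the two summands account for
    [c^-1] and [- ln c]. *)
Lemma xlnx_lipschitz c a b : 0 < c -> c <= a <= 1 -> c <= b <= 1 ->
  `|a * ln a - b * ln b| <= (c^-1 - ln c) * `|a - b|.
Proof.
move=> c0 /andP[ca a1] /andP[cb b1].
have a0 := lt_le_trans c0 ca; have b0 := lt_le_trans c0 cb.
have -> : a * ln a - b * ln b = b * (ln a - ln b) + ln a * (a - b) by ring.
apply: (le_trans (ler_normD _ _)); rewrite mulrDl !normrM; apply: lerD.
  apply: (@le_trans _ _ (1 * `|ln a - ln b|)).
    by rewrite ler_wpM2r// ger0_norm// ltW.
  by rewrite mul1r; exact: ln_lipschitz.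
rewrite ler_wpM2r// ler0_norm ?ln_le0// lerN2 ler_ln ?posrE//.
Qed.

End LogBounds.

(** * Translations of windows and shift invariance *)

Lemma addZ2A (u v w : Z2) : addZ2 u (addZ2 v w) = addZ2 (addZ2 u v) w.
Proof. by rewrite /addZ2 /= !addrA. Qed.

Lemma addZ2C (u v : Z2) : addZ2 u v = addZ2 v u.
Proof. by rewrite /addZ2 addrC [u.2 + _]addrC. Qed.

Lemma add0Z2 (u : Z2) : addZ2 origin u = u.
Proof. by case: u => a b; rewrite /addZ2/= !add0r. Qed.

Definition oppZ2 (v : Z2) : Z2 := (- v.1, - v.2)%R.

Lemma addNZ2 (u : Z2) : addZ2 (oppZ2 u) u = origin.
Proof. by rewrite /addZ2/= !addNr. Qed.

Lemma addZ2NK (u v : Z2) : addZ2 (addZ2 u (oppZ2 v)) v = u.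
Proof. by rewrite -addZ2A addNZ2 addZ2C add0Z2. Qed.

Definition translate (v : Z2) (W : set Z2) : set Z2 := (fun u => addZ2 u v) @` W.

Lemma finite_translate v W : finite_set W -> finite_set (translate v W).
Proof. exact: finite_image. Qed.

Lemma translateN v W : translate v (translate (oppZ2 v) W) = W.
Proof.
apply/seteqP; split => u /=.
  by move=> [_ [u' Wu' <-] <-]; rewrite addZ2NK.
by move=> Wu; exists (addZ2 u (oppZ2 v)); [exists u|rewrite addZ2NK].
Qed.

Section Shift.
Variables (R : realType) (U : finType) (u0 : U) (P : probability (OmegaM U u0) R).
Local Notation Om := (OmegaM U u0).
Local Notation E := (Ex P).
Local Notation sh := (@Defs.shift U u0).

Lemma loc_shift X W (f : Om -> X) v : local_on W f -> local_on (translate v W) (fun w => f (sh v w)).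
Proof. by move=> lf w w' ww; apply: lf => u Wu; apply: ww; exists u. Qed.

Lemma shift_shift u v w : sh u (sh v w) = sh (addZ2 u v) w.
Proof. by apply/funext => x; rewrite /Defs.shift addZ2A. Qed.

Lemma cyl_shift v W (w : Om) : sh v @^-1` cyl W (sh v w) = cyl (translate v W) w.
Proof.
apply/seteqP; split => e /= h.
  by move=> _ [u Wu <-]; exact: h.
by move=> u Wu; apply: h; exists u.
Qed.

Hypothesis statP : stationary P.

Lemma P_cyl_shift v W (w : Om) : finite_set W ->
  P (cyl (translate v W) w) = P (cyl W (sh v w)).
Proof. by move=> fW; rewrite -cyl_shift statP//; exact: measurable_cyl. Qed.

Lemma Ex_shift v W (f : Om -> R) : finite_set W -> local_on W f ->
  E (fun w => f (sh v w)) = E f.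
Proof.
move=> fW lf; have [I [c ex]] := @loc_expand R U u0 W fW.
have mc i : measurable (cyl W (c i)) by exact: measurable_cyl.
have msc i : measurable (sh v @^-1` cyl W (c i)).
  apply: (@loc_measurable _ _ (translate v W)); first exact: finite_translate.
  by apply: loc_shift; exact: loc_cyl.
transitivity (E (fun w => \sum_i f (c i) * \1_(sh v @^-1` cyl W (c i)) w)).
  by apply: eq_Ex => w; rewrite (ex f).
transitivity (E (fun w => \sum_i f (c i) * \1_(cyl W (c i)) w)); last first.
  by apply: eq_Ex => w; rewrite [RHS](ex f).
rewrite !Ex_sum; [|by move=> i; bmt|by move=> i; bmt].
apply: eq_bigr => i _; rewrite !ExZ; [|bmt|bmt].
by rewrite !Ex_indic// statP.
Qed.

End Shift.

Section Information.
Variables (R : realType) (U : finType) (u0 : U) (P : probability (OmegaM U u0) R).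
Local Notation Om := (OmegaM U u0).
Local Notation E := (Ex P).
Local Notation sh := (@Defs.shift U u0).
Implicit Types (W J : set Z2).

Definition site (y : U) : Om -> R := \1_[set w : Om | w origin = y].

(** The conditional information of the symbol at the origin given the pattern on [W]; the indicator
    conditioned on is that of the symbol that [w] itself shows. *)
Definition info W (w : Om) : R := - ln (cmean P (site (w origin)) W w).

Lemma measurable_site y : measurable [set w : Om | w origin = y].
Proof. exact: (@FJ_coord U u0 setT). Qed.

Lemma site_bmeas y : bmeas (site y).
Proof. by apply: bmeas_indic; exact: measurable_site. Qed.

Lemma site01 y w : 0 <= site y w <= 1.
Proof. by rewrite /site indicE; case: (_ \in _); rewrite /= ?ler01 ?lexx. Qed.

Lemma site_sum (F : U -> R) (w : Om) : F (w origin) = \sum_y site y w * F y.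
Proof.
rewrite (bigD1 (w origin : U))//= big1 ?addr0.
  by rewrite /site indicE mem_set// mul1r.
move=> y /eqP yw; rewrite /site indicE memNset ?mul0r//= => h; exact: yw.
Qed.

Lemma Ex_site_cyl y W w : finite_set W ->
  E (fun e => site y e * \1_(cyl W w) e) =
  fine (P (cyl W w `&` [set e : Om | e origin = y])).
Proof.
move=> fW; have mc := measurable_cyl w fW; have ms := measurable_site y.
rewrite -Ex_indic; last exact: measurableI.
apply: eq_Ex => e; rewrite /site setIC indicI//.
Qed.

Lemma loc_info W : local_on (W `|` [set origin]) (info W).
Proof.
move=> w w' ww; rewrite /info (ww origin); last by right.
by rewrite (@loc_cmean _ _ _ P (site (w' origin)) W w w')// => v Wv; apply: ww; left.
Qed.

Lemma finite_setU1 W v : finite_set W -> finite_set (W `|` [set v : Z2]).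
Proof. by move=> fW; rewrite finite_setU. Qed.

Lemma info_bmeas W : finite_set W -> bmeas (info W).
Proof.
move=> fW; apply: (@loc_bmeas _ _ _ (W `|` [set origin])); first exact: finite_setU1.
exact: loc_info.
Qed.

Hypothesis statP : stationary P.
Variable c0 : R.
Hypothesis c0_gt0 : 0 < c0.
Hypothesis condB : forall (y : U) (A : set Om), FJ U u0 (~` [set origin]) A -> (0 < P A)%E ->
  (c0%:E * P A < P (A `&` [set w : Om | w origin = y]))%E.

Lemma cyl_condB y W w : finite_set W -> ~ W origin -> 0 < fine (P (cyl W w)) ->
  c0 * fine (P (cyl W w)) < fine (P (cyl W w `&` [set e : Om | e origin = y])).
Proof.
move=> fW W0 Pw; have mc := measurable_cyl w fW; have ms := measurable_site y.
have fA : P (cyl W w) \is a fin_num by exact: fin_num_measure.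
have fB : P (cyl W w `&` [set e : Om | e origin = y]) \is a fin_num.
  by apply: fin_num_measure; exact: measurableI.
rewrite -lte_fin EFinM !fineK//; apply: condB; last by rewrite -(fineK fA) lte_fin.
by apply: (FJ_sub _ (FJ_cyl w fW)) => v Wv /= v0; apply: W0; rewrite -v0.
Qed.

Lemma P_cylU1 v W (w : Om) : finite_set W ->
  P (cyl (translate v W `|` [set v]) w) =
  P (cyl W (sh v w) `&` [set e : Om | e origin = sh v w origin]).
Proof.
move=> fW.
have -> : translate v W `|` [set v] = translate v (W `|` [set origin]).
  by rewrite /translate image_setU image_set1 add0Z2.
rewrite P_cyl_shift//; last exact: finite_setU1.
rewrite cylU; congr (P (_ `&` _)); apply/seteqP; split => e /=.
  by move=> /(_ origin erefl).
by move=> h _ ->.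
Qed.

(** Add the sites one by one. By stationarity the new site may be moved to the origin, and condition
    (B) then keeps at least a proportion [c0] of the mass. *)
Lemma cyl_gt0 W (w : Om) : finite_set W -> 0 < fine (P (cyl W w)).
Proof.
move=> /finite_seqP[s ->]; elim: s => [|v s IH] in w *.
  have -> : [set` [::]] = set0 :> set Z2 by apply/seteqP; split.
  by rewrite cyl0; have /= -> := probability_setT P.
have eqs : [set` (v :: s)] = [set` s] `|` [set v] :> set Z2.
  apply/seteqP; split => u /=; rewrite inE.
    by move=> /predU1P[->|]; [right|left].
  by move=> [->|->]; rewrite ?eqxx ?orbT.
have [vs|vs] := boolP (v \in s).
  suff <- : [set` s] = [set` (v :: s)] :> set Z2 by exact: IH.
  by rewrite eqs; apply/esym/setUidPl => _ ->.
pose W1 := translate (oppZ2 v) [set` s].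
have fW : finite_set W1 by apply: finite_translate; exact: finite_seq.
have W0 : ~ W1 origin.
  move=> [u /= us]; move=> /(congr1 (fun x => addZ2 x v)).
  rewrite addZ2NK add0Z2 => uv; move: vs; rewrite -uv.
  by rewrite us.
rewrite eqs -(translateN v [set` s]) -/W1 P_cylU1//.
apply: le_lt_trans (cyl_condB _ fW W0 _).
  by rewrite mulr_ge0 ?fine_ge0// ltW.
by rewrite -P_cyl_shift// translateN.
Qed.

Lemma cmean_site_gt y W w : finite_set W -> ~ W origin -> c0 < cmean P (site y) W w.
Proof.
move=> fW W0; have Pw := cyl_gt0 w fW.
by rewrite /cmean Ex_site_cyl// ltr_pdivlMr//; exact: cyl_condB.
Qed.

Lemma cmean_site_le1 y W w : finite_set W -> cmean P (site y) W w <= 1.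
Proof.
by move=> fW; apply: cmean_le => //; [exact: site_bmeas|move=> e; case/andP: (site01 y e)].
Qed.

Lemma c0_lt1 : c0 < 1.
Proof.
by apply: lt_le_trans (@cmean_site_gt u0 set0 point _ _) (cmean_site_le1 _ _ _).
Qed.

Lemma info_bounds W w : finite_set W -> ~ W origin -> 0 <= info W w <= - ln c0.
Proof.
move=> fW W0; have gt := cmean_site_gt (w origin) w fW W0.
rewrite /info oppr_ge0 ln_le0 ?cmean_site_le1//= lerN2 ler_ln ?posrE ?ltW//.
exact: lt_trans gt.
Qed.

(** The symbol at the origin is random, so the estimate sums over all symbols. Conditional
    probabilities stay above [c0], where [ln] has Lipschitz constant [c0^-1]. *)
Lemma info_dist W W' : finite_set W -> finite_set W' -> ~ W origin -> ~ W' origin ->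
  E (fun w => `|info W w - info W' w|) <=
  \sum_(y : U) c0^-1 * E (fun w => `|cmean P (site y) W w - cmean P (site y) W' w|).
Proof.
move=> fW fW' W0 W0'; have b1 := info_bmeas fW; have b2 := info_bmeas fW'.
have b3 y := cmean_bmeas P (site y) fW; have b4 y := cmean_bmeas P (site y) fW'.
apply: (@le_trans _ _ (E (fun w => \sum_(y : U) c0^-1 * `|cmean P (site y) W w - cmean P (site y) W' w|))).
  apply: ler_Ex; [bmt|bmt|] => w.
  rewrite /info opprK addrC (bigD1 (w origin : U))//=.
  apply: (@le_trans _ _ (c0^-1 * `|cmean P (site (w origin)) W w - cmean P (site (w origin)) W' w|)).
    by rewrite distrC; apply: ln_lipschitz => //; apply: ltW; exact: cmean_site_gt.
  rewrite lerDl; apply: sumr_ge0 => y _.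
  by rewrite mulr_ge0// invr_ge0 ltW.
rewrite Ex_sum; last by move=> y; bmt.
by apply: ler_sum => y _; rewrite ExZ//; bmt.
Qed.

(** Split according to the symbol at the origin: the logarithms are [W]-local, so each indicator may
    be replaced by its conditional mean. *)
Lemma Ex_info W : finite_set W -> E (info W) = E (fun w => Hent (fun y => cmean P (site y) W w)).
Proof.
move=> fW; have bs := site_bmeas; have bp y := cmean_bmeas P (site y) fW.
have bl y : bmeas (fun w => - ln (cmean P (site y) W w)).
  apply: (@loc_bmeas _ _ _ W) => //.
  exact: (loc_comp (fun x : R => - ln x) (@loc_cmean _ _ _ P (site y) W)).
transitivity (E (fun w => \sum_y site y w * - ln (cmean P (site y) W w))).
  by apply: eq_Ex => w; rewrite -(site_sum (fun y => - ln (cmean P (site y) W w))).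
transitivity (E (fun w => \sum_y cmean P (site y) W w * - ln (cmean P (site y) W w))).
  rewrite !Ex_sum; [|by move=> y; bmt|by move=> y; bmt].
  apply: eq_bigr => y _; rewrite cmean_proj//.
  exact: (loc_comp (fun x : R => - ln x) (@loc_cmean _ _ _ P (site y) W)).
by apply: eq_Ex => w; rewrite /Hent -sumrN; apply: eq_bigr => y _; rewrite mulrN.
Qed.

Lemma Info_step v W w : finite_set W -> ~ W origin ->
  Info P (translate v W `|` [set v]) w = Info P (translate v W) w + info W (sh v w).
Proof.
move=> fW W0; rewrite /Info /info P_cylU1// P_cyl_shift//.
rewrite -Ex_site_cyl// -cmean_cyl//; last exact: site_bmeas.
have gt := cmean_site_gt (sh v w origin) (sh v w) fW W0.
by rewrite lnM ?posrE ?cyl_gt0//; [ring|exact: lt_trans gt].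
Qed.

(** The chain rule, with each conditional information recentred at the site it concerns. Injectivity
    keeps the current site out of its own past. *)
Lemma Info_chain (v : nat -> Z2) N w : injective v ->
  Info P (v @` `I_N) w =
  \sum_(k < N) info (translate (oppZ2 (v k)) (v @` `I_k)) (sh (v k) w).
Proof.
move=> vI; elim: N => [|N IH].
  rewrite big_ord0 II0 image_set0 /Info cyl0; have /= -> := probability_setT P.
  by rewrite ln1 oppr0.
rewrite big_ord_recr/= -IH -{1}(translateN (v N) (v @` `I_N)) -Info_step.
- rewrite translateN; congr (Info P _ w); apply/seteqP; split => u /=.
    move=> [k /=]; rewrite ltnS leq_eqVlt => /predU1P[->|kN] <-; first by right.
    by left; exists k.
  by move=> [[k /= kN <-]|->]; [exists k => //=; exact: ltnW|exists N => /=].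
- by apply: finite_translate; apply: finite_image; exact: finite_II.
move=> [_ [k /= kN <-]] /(congr1 (fun x => addZ2 x (v N))).
by rewrite addZ2NK add0Z2 => /vI kN'; move: kN; rewrite kN' ltnn.
Qed.

End Information.

(** * Entropy of the past along a line *)

(** Passes from the abstract boxes to horizontal distance, the only distance needed since a digital
    line has one site per column. *)
Lemma box_fst_bound n : exists K : nat, forall v : Z2, box n v -> (`|v.1| <= K)%N.
Proof.
have /finite_seqP[s bs] := finite_box n.
exists (\max_(v <- s) `|v.1|)%N => v; rewrite bs /= => vs.
by rewrite (big_rem _ vs)/= leq_maxl.
Qed.

Definition recent_past (R : realType) (lam t : R) (K : nat) : set Z2 :=
  Lset lam t [set z : int | (- K%:Z <= z < 0)%R].

Definition full_past (R : realType) (lam t : R) : set Z2 :=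
  Lset lam t [set z : int | (z < 0)%R].

Lemma recent_past_sub (R : realType) (lam t : R) K : recent_past lam t K `<=` full_past lam t.
Proof. by move=> _ [z [/andP[_ z0] ->]]; exists z. Qed.

Lemma full_past_origin (R : realType) (lam t : R) : ~ full_past lam t origin.
Proof. by move=> [z [/= z0 [z0' _]]]; rewrite -z0' ltxx in z0. Qed.

Lemma recent_past_origin (R : realType) (lam t : R) K : ~ recent_past lam t K origin.
Proof. by move=> /recent_past_sub/full_past_origin. Qed.

Lemma finite_recent_past (R : realType) (lam t : R) K : finite_set (recent_past lam t K).
Proof.
apply: (@sub_finite_set _ _
  ((fun i : nat => (- i.+1%:Z, Num.floor (lam * (- i.+1%:Z)%:~R + t)) : Z2) @` `I_K)); last first.
  by apply: finite_image; exact: finite_II.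
move=> _ [z [/andP[Kz z0] ->]]; exists (`|z|.-1)%N => /=; first by lia.
by have -> : - (`|z|.-1.+1)%:Z = z :> int by lia.
Qed.

Lemma box_recent_past (R : realType) (lam t : R) n K k : (K <= k)%N ->
  (forall v : Z2, box n v -> (`|v.1| <= K)%N) ->
  full_past lam t `&` box n `<=` recent_past lam t k.
Proof.
move=> Kk hK _ [[z [/= z0 ->]] /hK /= zK]; exists z; split => //=; lia.
Qed.

Section PastEntropy.
Variables (R : realType) (U : finType) (u0 : U) (P : probability (OmegaM U u0) R).
Local Notation Om := (OmegaM U u0).
Local Notation E := (Ex P).
Local Notation site := (@site R U u0).
Hypothesis statP : stationary P.
Hypothesis H01 : strong_01_law P.
Variable c0 : R.
Hypothesis c0_gt0 : 0 < c0.
Hypothesis condB : forall (y : U) (A : set Om), FJ U u0 (~` [set origin]) A -> (0 < P A)%E ->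
  (c0%:E * P A < P (A `&` [set w : Om | w origin = y]))%E.

Lemma card_gt0 : 0 < #|U|%:R :> R.
Proof. by rewrite ltr0n; apply/card_gt0P; exists u0. Qed.

Lemma info_uniform e : 0 < e -> exists n, forall J W W',
  finite_set W -> finite_set W' -> ~ W origin -> ~ W' origin ->
  J `&` box n `<=` W -> W `<=` J `|` ~` box n ->
  J `&` box n `<=` W' -> W' `<=` J `|` ~` box n ->
  E (fun w => `|info P W w - info P W' w|) <= e.
Proof.
(* With this [d], the sum over all symbols of [c0^-1 * d] is exactly [e]. *)
move=> e0; pose d := e * c0 / #|U|%:R.
have d0 : 0 < d by rewrite divr_gt0 ?mulr_gt0// card_gt0.
have /choice[n hn] : forall y, exists n, forall J W W',
    finite_set W -> finite_set W' ->
    J `&` box n `<=` W -> W `<=` J `|` ~` box n ->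
    J `&` box n `<=` W' -> W' `<=` J `|` ~` box n ->
    E (fun w => (cmean P (site y) W w - cmean P (site y) W' w) ^+ 2) <= d ^+ 2.
  move=> y; apply: uniform_conditional_stability => //; [exact: site_bmeas|exact: site01|].
  by rewrite exprn_gt0.
exists (\max_y n y)%N => J W W' fW fW' W0 W0' JW WJ JW' WJ'.
have bmeas_ y : box (n y) `<=` box (\max_y n y) by apply: box_mono; exact: (leq_bigmax (F := n)).
apply: le_trans (info_dist statP c0_gt0 condB fW fW' W0 W0') _.
apply: (@le_trans _ _ (\sum_(y : U) c0^-1 * d)).
  apply: ler_sum => y _; apply: ler_wpM2l; first by rewrite invr_ge0 ltW.
  have b3 := cmean_bmeas P (site y) fW; have b4 := cmean_bmeas P (site y) fW'.
  apply: Ex_norm_le; [bmt|exact: ltW|]; apply: (hn y J) => //.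
  - by apply: subset_trans JW; exact: setIS.
  - by apply: (subset_trans WJ); apply: setUS; exact: subsetC.
  - by apply: subset_trans JW'; exact: setIS.
  - by apply: (subset_trans WJ'); apply: setUS; exact: subsetC.
rewrite sumr_const -mulr_natr /d; have := card_gt0; rewrite lt0r => /andP[U0 _].
by rewrite le_eqVlt; apply/orP; left; apply/eqP; field; rewrite U0 gt_eqF.
Qed.

(** Every sufficiently long recent past lies between the full past cut by [box n] and the full past.
    As [n] does not depend on the set, [K] does not depend on the intercept [t]. *)
Lemma info_past_stable (lam e : R) : 0 < e -> exists K, forall t k l, (K <= k)%N -> (K <= l)%N ->
  E (fun w => `|info P (recent_past lam t k) w - info P (recent_past lam t l) w|) <= e.
Proof.
move=> e0; have [n hn] := info_uniform e0.
have [K hK] := box_fst_bound n; exists K => t k l Kk Kl.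
apply: (hn (full_past lam t)).
- exact: finite_recent_past.
- exact: finite_recent_past.
- exact: recent_past_origin.
- exact: recent_past_origin.
- exact: box_recent_past hK.
- by move=> v /recent_past_sub; left.
- exact: box_recent_past hK.
- by move=> v /recent_past_sub; left.
Qed.

Section Version.
Variables (J : set Z2) (q : Om -> U -> R).
Hypothesis J0 : ~ J origin.
Hypothesis qP : is_cond_law P (FJ U u0 J) q.

(** A version of the conditional law lies in $[c_0,1]$ only almost surely. Clipping makes this hold
    everywhere, so that entropies become bounded functions. *)
Definition clip (x : R) : R := Num.max c0 (Num.min 1 x).

Lemma measurable_clip : measurable_fun setT clip.
Proof.
apply: measurable_maxr; first exact: measurable_cst.
by apply: measurable_minr; [exact: measurable_cst|exact: measurable_id].
Qed.

Lemma c0_le1 : c0 <= 1.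
Proof. by apply: ltW; exact: (c0_lt1 statP c0_gt0 condB). Qed.

Lemma clip_bounds x : c0 <= clip x <= 1.
Proof. by rewrite /clip le_max lexx/= ge_max c0_le1/= ge_min lexx. Qed.

Lemma FJ_version y (B : set R) : measurable B -> FJ U u0 J ((fun w => q w y) @^-1` B).
Proof. by have [m _] := qP y; exact: m. Qed.

Lemma measurable_version y : measurable_fun setT (fun w => q w y).
Proof. by move=> _ B mB; rewrite setTI; apply: FJ_measurable (FJ_version y mB). Qed.

Lemma version_integral y (A : set Om) : FJ U u0 J A ->
  (\int[P]_(w in A) (q w y)%:E)%E = P (A `&` [set w : Om | w origin = y]).
Proof. by have [_ [_]] := qP y; exact. Qed.

Lemma version_integrable y (A : set Om) : FJ U u0 J A ->
  P.-integrable A (EFin \o (fun w => q w y)).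
Proof.
move=> FA; have [_ [iq _]] := qP y.
by apply: (@integrableS _ _ _ P setT) => //; exact: FJ_measurable FA.
Qed.

Lemma cst_integrable (c : R) (A : set Om) : measurable A -> P.-integrable A (EFin \o (fun=> c)).
Proof.
move=> mA; apply: (@integrableS _ _ _ P setT) => //.
by apply: bmeas_integrable; exact: bmeas_cst.
Qed.

(** If the event had positive mass, condition (B) would make the integral of [q] over it exceed [c0]
    times that mass. As [J] misses the origin, the event is admissible there. *)
Lemma version_ge y : P [set w | q w y < c0] = 0.
Proof.
set A := [set w | _].
have FA : FJ U u0 J A.
  rewrite (_ : A = (fun w => q w y) @^-1` [set x | x < c0]); last by [].
  by apply: FJ_version; rewrite -set_itvNyo; exact: measurable_itv.
have mA := FJ_measurable FA.
have [//|PA] := eqVneq (P A) 0%E.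
have PA0 : (0 < P A)%E by rewrite lt0e PA measure_ge0.
have FA' : FJ U u0 (~` [set origin]) A.
  by apply: FJ_sub FA => v Jv /= v0; apply: J0; rewrite -v0.
have := condB y FA' PA0; rewrite -version_integral//.
suff : (\int[P]_(w in A) (q w y)%:E <= c0%:E * P A)%E.
  by move=> h1 h2; have := le_lt_trans h1 h2; rewrite ltxx.
rewrite -integral_cst//; apply: le_integral => //.
- exact: version_integrable.
- exact: cst_integrable.
- by move=> w; rewrite inE /A/= lee_fin => /ltW.
Qed.

(** Cover the event by countably many on which [q] is at least [1 + n.+1%:R^-1]. Each is null,
    because the integral of [q] over it is at most its probability. *)
Lemma version_le y : P.-negligible [set w | 1 < q w y].
Proof.
pose A n := [set w | 1 + n.+1%:R^-1 <= q w y].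
apply: (@negligibleS _ _ _ _ (\bigcup_n A n)); last first.
  apply: negligible_bigcup => n.
  have FA : FJ U u0 J (A n).
    rewrite (_ : A n = (fun w => q w y) @^-1` [set x | 1 + n.+1%:R^-1 <= x]); last by [].
    by apply: FJ_version; rewrite -set_itvcy; exact: measurable_itv.
  have mA := FJ_measurable FA; have ms := @measurable_site U u0 y.
  apply/negligibleP => //.
  have h : ((1 + n.+1%:R^-1)%:E * P (A n) <= P (A n))%E.
    apply: (@le_trans _ _ (\int[P]_(w in A n) (q w y)%:E)%E).
      rewrite -integral_cst//; apply: le_integral => //.
      - exact: cst_integrable.
      - exact: version_integrable.
      - by move=> w; rewrite inE.
    by rewrite version_integral//; apply: le_measure; rewrite ?inE//; exact: measurableI.
  have fA : P (A n) \is a fin_num by exact: fin_num_measure.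
  move: h; rewrite -(fineK fA) -EFinM lee_fin mulrDl mul1r gerDl => h.
  have n0 : 0 < n.+1%:R^-1 :> R by rewrite invr_gt0 ltr0n.
  have h0 : fine (P (A n)) = 0.
    by apply/eqP; rewrite eq_le fine_ge0// andbT; move: h; rewrite pmulr_rle0.
  by have := fineK fA; rewrite h0; exact: esym.
move=> w /= qw; have [n hn] := ltr_add_invr qw.
by exists n => //; rewrite /A/=; exact: ltW.
Qed.

Lemma version_clip y : {ae P, forall w, q w y = clip (q w y)}.
Proof.
have n1 : P.-negligible [set w | q w y < c0].
  apply/negligibleP; last exact: version_ge.
  rewrite -[X in measurable X]setTI.
  by apply: (measurable_fun_ltr (@measurable_version y) (measurable_cst c0)) => //; exact: measurable_set1.
apply: negligibleS (negligibleU n1 (version_le y)) => w /= h.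
have [qc|qc] := ltP (q w y) c0; first by left.
have [q1|q1] := ltP 1 (q w y); first by right.
by exfalso; apply: h; rewrite /clip (min_idPr q1) (max_idPr qc).
Qed.

Lemma clip_bmeas y : bmeas (fun w => clip (q w y)).
Proof.
split; first by apply: (measurableT_comp measurable_clip); exact: measurable_version.
exists 1 => w; have /andP[h1 h2] := clip_bounds (q w y).
by rewrite ger0_norm//; exact: le_trans (ltW c0_gt0) h1.
Qed.

Lemma clip_proj y W h : finite_set W -> W `<=` J -> local_on W h ->
  E (fun w => clip (q w y) * h w) = E (fun w => site y w * h w).
Proof.
move=> fW WJ lh; have [I [c ex]] := @loc_expand R U u0 W fW.
have mc i : measurable (cyl W (c i)) by exact: measurable_cyl.
have bs := site_bmeas R u0 y; have bq := clip_bmeas y.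
transitivity (E (fun w => \sum_i h (c i) * (clip (q w y) * \1_(cyl W (c i)) w))).
  apply: eq_Ex => w; rewrite {1}(ex h)// mulr_sumr.
  by apply: eq_bigr => i _; ring.
transitivity (E (fun w => \sum_i h (c i) * (site y w * \1_(cyl W (c i)) w))); last first.
  apply: eq_Ex => w; rewrite [in RHS](ex h)// mulr_sumr.
  by apply: eq_bigr => i _; ring.
rewrite !Ex_sum; [|by move=> i; bmt|by move=> i; bmt].
apply: eq_bigr => i _; rewrite !ExZ; [|bmt|bmt]; congr (_ * _).
rewrite Ex_site_cyl//.
have FC : FJ U u0 J (cyl W (c i)) by apply: FJ_sub (FJ_cyl _ fW).
rewrite -version_integral// /Ex /Rintegral; congr fine.
rewrite [RHS]integral_mkcond; apply: ae_eq_integral => //.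
- by apply/measurable_EFinP; apply: (bmeasM bq (bmeas_indic R (mc i))).1.
- apply/(measurable_restrictT _ _).1 => //; apply/measurable_EFinP.
  by apply: measurable_funS (measurable_version y).
apply: filterS (version_clip y) => w /= <- _.
rewrite patchE indicE; case: ifPn => _; by rewrite ?mulr1 ?mulr0.
Qed.

Lemma clip_level y (c : R) : FJ U u0 J [set w | c <= clip (q w y)].
Proof.
rewrite (_ : [set w | _] = (fun w => q w y) @^-1` [set x | c <= clip x]); last by [].
apply: FJ_version; rewrite -[X in measurable X]setTI.
by apply: (measurable_fun_ler (measurable_cst c) measurable_clip) => //; exact: measurable_set1.
Qed.

Lemma Hent_bmeas : bmeas (fun w => Hent (fun y => clip (q w y))).
Proof.
rewrite /Hent; apply: bmeasN; apply: bmeas_sum => y; apply: bmeasM; first exact: clip_bmeas.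
split; first by apply: (measurableT_comp (@measurable_ln R)); case: (clip_bmeas y).
exists (- ln c0) => w; have /andP[h1 h2] := clip_bounds (q w y).
rewrite ler0_norm ?ln_le0// lerN2 ler_ln ?posrE//; exact: lt_le_trans h1.
Qed.

Lemma integral_Hent :
  (\int[P]_w (Hent (q w))%:E)%E = (E (fun w => Hent (fun y => clip (q w y))))%:E.
Proof.
rewrite -EFin_Ex; last exact: Hent_bmeas.
have mq := measurable_version.
apply: ae_eq_integral => //.
- apply/measurable_EFinP; rewrite /Hent; apply: measurable_funN.
  apply: measurable_sum => y; apply: measurable_funM => //.
  exact: (measurableT_comp (@measurable_ln R)).
- by apply/measurable_EFinP; case: Hent_bmeas.
have : {ae P, forall w, forall y, q w y = clip (q w y)}.
  have : {ae P, forall w, forall y, y \in enum U -> q w y = clip (q w y)}.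
    elim: (enum U) => [|y s IH]; first by apply: aeW => w y.
    apply: filterS2 IH (version_clip y) => w h1 h2 z.
    by rewrite inE => /predU1P[->|/h1].
  by apply: filterS => w h y; apply: h; rewrite mem_enum.
apply: filterS => w h _; congr EFin; rewrite /Hent; congr (- _).
by apply: eq_bigr => y _; rewrite -h.
Qed.

(** The mean of [info P W] is a mean entropy, so it suffices to compare conditional probabilities
    symbol by symbol; [L] is the Lipschitz constant of $x\ln x$ on $[c_0,1]$. *)
Lemma entropy_converges e : 0 < e -> exists n, forall W, finite_set W ->
  J `&` box n `<=` W -> W `<=` J ->
  `|E (fun w => Hent (fun y => clip (q w y))) - E (info P W)| <= e.
Proof.
move=> e0; pose L := c0^-1 - ln c0.
have L0 : 0 < L by rewrite ltr_wpDr ?invr_gt0// oppr_ge0 ln_le0 ?c0_le1.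
pose d := e / L / #|U|%:R.
have d0 : 0 < d by rewrite !divr_gt0// card_gt0.
have /choice[n hn] : forall y, exists n, forall W, finite_set W ->
    J `&` box n `<=` W -> W `<=` J ->
    E (fun w => (clip (q w y) - cmean P (site y) W w) ^+ 2) <= d ^+ 2.
  move=> y; apply: cmean_converges.
  - exact: site_bmeas.
  - exact: clip_bmeas.
  - by move=> w; have /andP[h1 ->] := clip_bounds (q w y); rewrite andbT (le_trans (ltW c0_gt0)).
  - exact: clip_level.
  - by move=> W h fW WJ lh; exact: (@clip_proj y W h).
  - by rewrite exprn_gt0.
exists (\max_y n y)%N => W fW JW WJ.
have W0 : ~ W origin by move=> /WJ.
have bq := clip_bmeas; have bp y := cmean_bmeas P (site y) fW.
rewrite Ex_info//.
have bH : bmeas (fun w => Hent (fun y => cmean P (site y) W w)).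
  apply: (loc_bmeas fW) => w w' ww; rewrite /Hent; congr (- _); apply: eq_bigr => y _.
  by rewrite (@loc_cmean _ _ _ P (site y) W w w').
have bH' := Hent_bmeas.
rewrite -ExB//; apply: (le_trans (Ex_normr _ _)); first by bmt.
apply: (@le_trans _ _ (E (fun w => \sum_y L * `|clip (q w y) - cmean P (site y) W w|))).
  apply: ler_Ex; [bmt|bmt|] => w.
  rewrite /Hent opprK addrC -sumrB; apply: (le_trans (ler_norm_sum _ _ _)).
  apply: ler_sum => y _; rewrite distrC; apply: xlnx_lipschitz => //.
    exact: clip_bounds.
  apply/andP; split; last exact: cmean_site_le1.
  by apply: ltW; exact: (cmean_site_gt statP c0_gt0 condB).
rewrite Ex_sum; last by move=> y; bmt.
apply: (@le_trans _ _ (\sum_(y : U) L * d)).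
  apply: ler_sum => y _; rewrite ExZ; last by bmt.
  apply: ler_wpM2l; first exact: ltW.
  apply: Ex_norm_le; [exact: bmeasB|exact: ltW|].
  apply: hn => //; apply: subset_trans JW; apply: setIS.
  by apply: box_mono; exact: (leq_bigmax (F := n)).
rewrite sumr_const -mulr_natr /d; have := card_gt0; rewrite lt0r => /andP[U0 _].
by rewrite le_eqVlt; apply/orP; left; apply/eqP; field; rewrite U0 gt_eqF.
Qed.

End Version.

Definition past_entropy (q : R -> Om -> U -> R) (t : R) : R :=
  E (fun w => Hent (fun y => clip (q t w y))).

(** For fixed [t] some window length works, but it depends on [t]. Stability of long pasts compares
    that length with [k] uniformly in [t]. *)
Lemma past_entropy_uniform (lam : R) (q : R -> Om -> U -> R) e :
  (forall t : R, is_cond_law P (past U u0 lam t) (q t)) -> 0 < e ->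
  exists K, forall t k, (K <= k)%N ->
    `|past_entropy q t - E (info P (recent_past lam t k))| <= e.
Proof.
move=> qP e0; have e20 : 0 < e / 2 by lra.
have [K hK] := info_past_stable lam e20; exists K => t k Kk.
have [n hn] := entropy_converges (@full_past_origin _ lam t) (qP t) e20.
have [K' hK'] := box_fst_bound n.
have := hn (recent_past lam t (maxn K K')) (@finite_recent_past _ _ _ _)
  (box_recent_past (leq_maxr K K') hK') (@recent_past_sub _ _ _ _).
have fk j := @finite_recent_past _ lam t j.
have bk j := info_bmeas P (fk j).
have : `|E (info P (recent_past lam t (maxn K K'))) - E (info P (recent_past lam t k))| <= e / 2.
  rewrite -ExB//; apply: (le_trans (Ex_normr _ _)); first by apply: bmeasB.
  by apply: hK => //; exact: leq_maxl.
move=> h1 h2; apply: (le_trans (ler_distD (E (info P (recent_past lam t (maxn K K')))) _ _)).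
by apply: le_trans (lerD h2 h1) _; lra.
Qed.

End PastEntropy.

(** * Rotations and bounded remainder intervals *)

Section Rotation.
Variable R : realType.
Implicit Types (lam a t x : R) (z : int).

Definition fpart x : R := x - (Num.floor x)%:~R.

Lemma fpart_bounds x : 0 <= fpart x < 1.
Proof. by rewrite /fpart; have := floor_itv x; rewrite intrD; lra. Qed.

Lemma fpart_addz x z : fpart (x + z%:~R) = fpart x.
Proof. by rewrite /fpart floorDrz ?intr_int// intrKfloor intrD; ring. Qed.

(** The intercept in $(0,1]$ at which $\lfloor\lambda z+t\rfloor$ jumps by one; the value 1 means no
    jump on $[0,1)$. *)
Definition theta lam z : R := 1 - fpart (lam * z%:~R).

Lemma theta_bounds lam z : 0 <= theta lam z <= 1.
Proof. by rewrite /theta; have := fpart_bounds (lam * z%:~R); lra. Qed.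

Lemma floor_theta lam z t : 0 <= t < 1 ->
  Num.floor (lam * z%:~R + t) = Num.floor (lam * z%:~R) + 1 - ((t < theta lam z)%R : nat)%:Z.
Proof.
move=> t01; apply: floor_def; have := floor_itv (lam * z%:~R).
rewrite !(intrD, intrB) -!pmulrn /theta /fpart => /andP[f1 f2]; case/andP: t01 => t0 t1.
by case: ltP => /= h; apply/andP; split; lra.
Qed.

(* The interval [0, theta) is a bounded remainder set for the rotation by [lam]:
   its indicator is cohomologous to a constant. *)
Lemma theta_coboundary lam z t : 0 <= t < 1 ->
  (t < theta lam z)%R%:R - theta lam z = fpart (lam * z%:~R + t) - t.
Proof.
move=> t01; rewrite {1}/fpart floor_theta// !(intrD, intrB) -!pmulrn /theta /fpart; ring.
Qed.

Definition intercept lam a (k : nat) : R := fpart (lam * k%:R + a).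

(** By the coboundary identity the summand is [u (k - j) - u k]. Increasing [j] by one adds a
    telescoping sum, the difference of two values in $[0,1)$, hence at most 1. *)
Lemma theta_discrepancy lam a (j N : nat) :
  `|\sum_(k < N) ((intercept lam a k < theta lam (- j%:Z))%R%:R - theta lam (- j%:Z))| <= j%:R :> R.
Proof.
pose u z := fpart (lam * z%:~R + a).
have -> : \sum_(k < N) ((intercept lam a k < theta lam (- j%:Z))%R%:R - theta lam (- j%:Z)) =
    \sum_(k < N) (u (k%:Z - j%:Z) - u k%:Z) :> R.
  apply: eq_bigr => k _; rewrite theta_coboundary; last exact: fpart_bounds.
  congr (_ - _); rewrite /u /intercept -[RHS](fpart_addz _ (- Num.floor (lam * k%:R + a))).
  by congr fpart; rewrite /fpart !(intrD, intrN, mulrN, mulrBr); ring.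
elim: j => [|j IH].
  by rewrite big1 ?normr0// => k _; rewrite subr0 subrr.
have tel : \sum_(k < N) (u (k%:Z - j.+1%:Z) - u (k%:Z - j%:Z)) =
    u (- j.+1%:Z) - u (N%:Z - j.+1%:Z).
  elim: N {IH} => [|N IH]; first by rewrite big_ord0 sub0r subrr.
  rewrite big_ord_recr/= IH.
  by rewrite (_ : N.+1%:Z - j.+1%:Z = N%:Z - j%:Z); [ring|lia].
have -> : \sum_(k < N) (u (k%:Z - j.+1%:Z) - u k%:Z) =
    \sum_(k < N) (u (k%:Z - j.+1%:Z) - u (k%:Z - j%:Z)) + \sum_(k < N) (u (k%:Z - j%:Z) - u k%:Z).
  by rewrite -big_split/=; apply: eq_bigr => k _; ring.
apply: (le_trans (ler_normD _ _)); rewrite tel -natr1 addrC; apply: lerD => //.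
have := fpart_bounds (lam * (- j.+1%:Z)%:~R + a).
have := fpart_bounds (lam * (N%:Z - j.+1%:Z)%:~R + a).
by rewrite /u => h1 h2; rewrite ler_norml; apply/andP; split; lra.
Qed.

Definition unit_itv : set R := `[0, 1[%classic.
Definition mean01 (f : R -> R) : R := Rintegral lebesgue_measure unit_itv f.

Lemma measurable_unit_itv : measurable unit_itv.
Proof. exact: measurable_itv. Qed.
Hint Resolve measurable_unit_itv : core.

Lemma lebesgue_unit_itv : lebesgue_measure unit_itv = 1%E.
Proof. by rewrite lebesgue_measure_itv/= lte_fin ltr01 sube0. Qed.

Lemma bmeas_integrable01 (f : R -> R) (M : R) : measurable_fun unit_itv f ->
  (forall t, 0 <= t < 1 -> `|f t| <= M) -> lebesgue_measure.-integrable unit_itv (EFin \o f).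
Proof.
move=> mf fM; apply: measurable_bounded_integrable => //.
- by have /= -> := lebesgue_unit_itv; exact: ltry.
- exists M; split; first exact: num_real.
  move=> x Mx t; rewrite /unit_itv/= in_itv/= => t01; exact: le_trans (fM _ t01) (ltW Mx).
Qed.

Lemma bmeas_integrable_unit (f : R -> R) : bmeas f -> lebesgue_measure.-integrable unit_itv (EFin \o f).
Proof.
move=> [mf [M fM]]; apply: (@bmeas_integrable01 f M) => //.
exact: measurable_funS mf.
Qed.

Lemma mean01D f g : bmeas f -> bmeas g -> mean01 (fun t => f t + g t) = mean01 f + mean01 g.
Proof. by move=> bf bg; apply: RintegralD => //; exact: bmeas_integrable_unit. Qed.

Lemma mean01_cst c : mean01 (fun=> c) = c.
Proof. by rewrite /mean01 Rintegral_cst//; have /= -> := lebesgue_unit_itv; rewrite mulr1. Qed.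

Lemma mean01Z c f : bmeas f -> mean01 (fun t => c * f t) = c * mean01 f.
Proof. by move=> bf; apply: RintegralZl => //; exact: bmeas_integrable_unit. Qed.

Lemma bmeas_lt (x : R) : bmeas (fun t : R => (t < x)%R%:R : R).
Proof.
have -> : (fun t : R => (t < x)%R%:R : R) = \1_([set` `]-oo, x[]).
  by apply/funext => t; rewrite indicE mem_setE in_itv.
by apply: bmeas_indic; exact: measurable_itv.
Qed.

Lemma mean01_lt (x : R) : 0 <= x <= 1 -> mean01 (fun t => (t < x)%R%:R) = x.
Proof.
move=> /andP[x0 x1]; rewrite /mean01.
have -> : (fun t : R => (t < x)%R%:R : R) = \1_([set` `]-oo, x[]).
  by apply/funext => t; rewrite indicE mem_setE in_itv.
rewrite /Rintegral integral_indic//.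
have -> : [set` `]-oo, x[] `&` unit_itv = [set` `[0, x[].
  apply/seteqP; split => t /=; rewrite /unit_itv/= !in_itv/=; first by move=> []; lra.
  by move=> h; split; lra.
have /= -> := @lebesgue_measure_itv R `[0%R, x[.
rewrite lte_fin; case: ltP => [_|]; first by rewrite sube0.
by move=> x0'; apply/eqP; rewrite eq_le x0.
Qed.

(** A discrepancy bounded uniformly in the starting point and in [N]: this is stable under linear
    combinations and gives averages with an error of order $1/N$. *)
Definition equidistributed lam (f : R -> R) : Prop := bmeas f /\ exists C : R, forall a N,
  `|\sum_(k < N) f (intercept lam a k) - N%:R * mean01 f| <= C.

Lemma equidistributedD lam f g : equidistributed lam f -> equidistributed lam g ->
  equidistributed lam (fun t => f t + g t).
Proof.
move=> [bf [C hC]] [bg [D hD]]; split; first exact: bmeasD.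
exists (C + D) => a N; rewrite mean01D// big_split/= mulrDr opprD addrACA.
by apply: (le_trans (ler_normD _ _)); apply: lerD; [exact: hC|exact: hD].
Qed.

Lemma equidistributedZ lam c f : equidistributed lam f ->
  equidistributed lam (fun t => c * f t).
Proof.
move=> [bf [C hC]]; split; first exact: bmeasZ.
exists (`|c| * C) => a N; rewrite mean01Z// -mulr_sumr mulrCA -mulrBr normrM.
by rewrite ler_wpM2l.
Qed.

Definition good_threshold lam x := equidistributed lam (fun t => (t < x)%R%:R).

Lemma good_theta lam (j : nat) : good_threshold lam (theta lam (- j%:Z)).
Proof.
split; first exact: bmeas_lt.
exists j%:R => a N; rewrite mean01_lt ?theta_bounds//.
apply: le_trans (theta_discrepancy lam a j N).
by rewrite sumrB sumr_const card_ord mulr_natl.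
Qed.

Lemma good_one lam : good_threshold lam 1.
Proof.
split; first exact: bmeas_lt.
exists 0 => a N; rewrite mean01_lt ?ler01 ?lexx// mulr1.
rewrite (eq_bigr (fun=> 1)) ?sumr_const ?card_ord ?subrr ?normr0// => k _.
by have /andP[_ ->] := fpart_bounds (lam * k%:R + a).
Qed.

(** Induction on the thresholds, carrying a cut-off [x]. Splitting at [s] produces only the cut-offs
    [x] and [Num.min s x], and the minimum of two good thresholds is one of them. *)
Lemma equidistributed_pattern lam (S : seq R) (x : R) (F : seq bool -> R) :
  (forall s, s \in S -> good_threshold lam s) -> good_threshold lam x ->
  equidistributed lam (fun t => F [seq t < s | s <- S] * (t < x)%R%:R).
Proof.
elim: S x F => [|s S IH] x F gS gx /=; first exact: equidistributedZ.
have gs : good_threshold lam s by apply: gS; rewrite mem_head.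
have gS' r : r \in S -> good_threshold lam r by move=> rS; apply: gS; rewrite inE rS orbT.
have gm : good_threshold lam (Num.min s x) by case: (leP s x).
have e1 := IH _ (F \o cons true) gS' gm.
have e2 := IH _ (F \o cons false) gS' gx.
have e3 := equidistributedZ (-1) (IH _ (F \o cons false) gS' gm).
have := equidistributedD e1 (equidistributedD e2 e3).
congr (equidistributed lam _); apply/funext => t /=.
by rewrite lt_min; case: (t < s); case: (t < x); rewrite /=; ring.
Qed.

(* The last [K] sites of the discrete line, read off from the comparisons of the
   intercept with the thresholds [theta (-1)], ..., [theta (-K)]. *)
Definition pattern_past lam (K : nat) (b : seq bool) : set Z2 :=
  [set v : Z2 | exists z : int, (- K%:Z <= z < 0)%R /\
     v = (z, Num.floor (lam * z%:~R) + 1 - (nth false b `|z|.-1 : nat)%:Z)].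

Definition thresholds lam K : seq R := [seq theta lam (- j.+1%:Z) | j <- iota 0 K].

Lemma recent_pastE lam t K : 0 <= t < 1 ->
  recent_past lam t K = pattern_past lam K [seq t < s | s <- thresholds lam K].
Proof.
move=> t01.
have H (z : int) : (- K%:Z <= z < 0)%R ->
    Num.floor (lam * z%:~R + t) = Num.floor (lam * z%:~R) + 1 -
      (nth false [seq t < s | s <- thresholds lam K] `|z|.-1 : nat)%:Z.
  move=> zK; have zi : (`|z|.-1 < K)%N by lia.
  rewrite (nth_map 0) ?size_map ?size_iota// (nth_map 0%N) ?size_iota// nth_iota// floor_theta//.
  by rewrite (_ : - (0 + `|z|.-1).+1%:Z = z)//; lia.
by apply/seteqP; split => v [z [zK ->]]; exists z; split => //; rewrite H.
Qed.

(** On $[0,1)$ the recent past depends only on the comparisons with finitely many good thresholds,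
    so [G] can be arbitrary; the cut-off 1 is invisible there. *)
Lemma equidistributed_past lam K (G : set Z2 -> R) :
  exists f, equidistributed lam f /\ forall t, 0 <= t < 1 -> f t = G (recent_past lam t K).
Proof.
pose F b := G (pattern_past lam K b).
exists (fun t => F [seq t < s | s <- thresholds lam K] * (t < 1)%R%:R); split.
  apply: equidistributed_pattern; last exact: good_one.
  by move=> s /mapP[j _ ->]; exact: good_theta.
by move=> t t01; rewrite recent_pastE//; case/andP: t01 => _ ->; rewrite mulr1.
Qed.

End Rotation.

(** * Law of large numbers along a line *)

Lemma sum_window (R : realType) (a b N : nat) : (a <= b)%N ->
  \sum_(l < N) ((a <= l) && (l < b))%N%:R <= (b - a)%:R :> R.
Proof.
move=> ab; have H : (\sum_(l < N) ((a <= l) && (l < b)) = minn N b - minn N a)%N.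
  elim: N => [|N IH]; first by rewrite big_ord0 !min0n.
  rewrite big_ord_recr/= IH; case: (leqP a N); case: (ltnP N b) => /=; lia.
by rewrite -natr_sum H ler_nat; lia.
Qed.

Section Line.
Variables (R : realType) (lam : R).

Definition line (a : R) (z0 : int) (k : nat) : Z2 :=
  (z0 + k%:Z, Num.floor (lam * (z0 + k%:Z)%:~R + a)).

Lemma line_inj a z0 : injective (line a z0).
Proof. by move=> k l [/addrI []]. Qed.

(** Seen from its [k]-th site, the line has as intercept the fractional part of its height there:
    subtracting the integer part commutes with taking floors. *)
Lemma line_past a z0 k :
  translate (oppZ2 (line a z0 k)) (line a z0 @` `I_k) =
  recent_past lam (intercept lam (lam * z0%:~R + a) k) k.
Proof.
have H (j : nat) : Num.floor (lam * (j%:Z - k%:Z)%:~R + intercept lam (lam * z0%:~R + a) k) =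
    Num.floor (lam * (z0 + j%:Z)%:~R + a) - Num.floor (lam * (z0 + k%:Z)%:~R + a).
  rewrite /intercept /fpart (_ : lam * k%:R + (lam * z0%:~R + a) = lam * (z0 + k%:Z)%:~R + a); last first.
    by rewrite intrD -pmulrn; ring.
  set f := Num.floor (lam * (z0 + k%:Z)%:~R + a).
  rewrite (_ : lam * (j%:Z - k%:Z)%:~R + _ = (lam * (z0 + j%:Z)%:~R + a) + (- f)%:~R); last first.
    by rewrite !(intrD, intrN, intrB); ring.
  by rewrite floorDrz ?intr_int// intrKfloor.
apply/seteqP; split => v /=.
  move=> [_ [j /= jk <-] <-]; exists (j%:Z - k%:Z); split; first by rewrite /=; lia.
  by rewrite H /addZ2 /oppZ2 /line/=; congr pair; ring.
move=> [z [/= zk ->]]; have [j zE] : exists j : nat, z = j%:Z - k%:Z.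
  by exists (absz (z + k%:Z)%R); lia.
exists (line a z0 j); first by exists j => //=; lia.
by rewrite zE H /addZ2 /oppZ2 /line/=; congr pair; ring.
Qed.

Lemma card_line a z0 N : cardZ2 R (line a z0 @` `I_N) = N%:R.
Proof.
rewrite /cardZ2.
have -> : line a z0 @` `I_N = [set` [seq line a z0 k | k <- iota 0 N]].
  apply/seteqP; split => v /=.
    by move=> [k /= kN <-]; apply/mapP; exists k => //; rewrite mem_iota.
  by move=> /mapP[k]; rewrite mem_iota => /andP[_ kN] ->; exists k.
rewrite -fsbig_seq; last by rewrite map_inj_uniq ?iota_uniq//; exact: line_inj.
by rewrite big_map -[in RHS](size_iota 0 N) -sum1_size natr_sum.
Qed.

Lemma Ln_line (x x' : R) n b : x < x' -> exists z0 N,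
  Ln lam x x' n b = line (n%:R * b) z0 @` `I_N /\ n%:R * (x' - x) - 1 <= N%:R.
Proof.
move=> xx; have nn : n%:R * x <= n%:R * x' by rewrite ler_wpM2l// ltW.
pose z0 := Num.ceil (n%:R * x); pose z1 := Num.floor (n%:R * x').
have := ceil_itv (n%:R * x); have := floor_itv (n%:R * x').
rewrite -/z0 -/z1 !(intrD, intrB) => /andP[f1 f2] /andP[c1 c2].
(* If no integer lies in the interval, [z1 + 1 - z0] is still nonnegative, so the absolute value
   taken below does not alter it. *)
have z01 : z0 <= z1 + 1.
  rewrite -ltzD1 -(ltr_int R) !(intrD, intrB); lra.
exists z0; exists (absz (z1 + 1 - z0)%R); split.
  apply/seteqP; split => v /=.
    move=> [z [/andP[h1 h2] ->]]; rewrite -ceil_le_int -/z0 in h1.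
    rewrite -floor_ge_int -/z1 in h2.
    exists `|z - z0|%N => /=; first by lia.
    by rewrite /line (_ : z0 + `|z - z0|%N%:Z = z)//; lia.
  move=> [k /= kN <-]; exists (z0 + k%:Z); split => //.
  by rewrite -ceil_le_int -floor_ge_int -/z0 -/z1; lia.
rewrite [leRHS]pmulrn (_ : (absz (z1 + 1 - z0)%R)%:Z = z1 + 1 - z0); last by lia.
by rewrite !(intrD, intrB); lra.
Qed.

End Line.

(** * Decay of correlations, error terms and the uniform limit *)

Section Main.
Variables (R : realType) (U : finType) (u0 : U) (P : probability (OmegaM U u0) R).
Local Notation Om := (OmegaM U u0).
Local Notation E := (Ex P).
Local Notation sh := (@Defs.shift U u0).
Hypothesis statP : stationary P.
Hypothesis H01 : strong_01_law P.

Lemma cmean0 (Y : Om -> R) w : cmean P Y set0 w = E Y.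
Proof.
rewrite /cmean cyl0; have /= -> := probability_setT P; rewrite /= divr1.
by apply: eq_Ex => e; rewrite indicE in_setT mulr1.
Qed.

(** Stability with [J] empty: a window far from the origin hardly changes the conditional mean of
    [Y] from its plain mean. *)
Lemma mixing (Y : Om -> R) e : bmeas Y -> (forall w, 0 <= Y w <= 1) -> 0 < e ->
  exists D : nat, forall W (h : Om -> R) M, finite_set W -> local_on W h ->
    (forall v, W v -> (D < `|v.1|)%N) -> (forall w, `|h w| <= M) ->
    `|E (fun w => Y w * h w) - E Y * E h| <= M * e.
Proof.
move=> bY Y01 e0.
have [n hn] := conditional_stability bY Y01 H01 set0 (exprn_gt0 2 e0).
have [D hD] := box_fst_bound n; exists D => W h M fW lh WD hM.
have bh := loc_bmeas fW lh; have bp := cmean_bmeas P Y fW.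
have M0 : 0 <= M by apply: le_trans (hM point).
have Wn : W `<=` set0 `|` ~` box n.
  by move=> v Wv; right => /hD vD; have := WD v Wv; lia.
have := hn W fW; rewrite set0I => /(_ (@sub0set _ _) Wn) d.
rewrite -(cmean_proj P fW bY lh).
have -> : E (fun w => cmean P Y W w * h w) - E Y * E h = E (fun w => (cmean P Y W w - E Y) * h w).
  rewrite -ExZ// -ExB; [|bmt|bmt]; by apply: eq_Ex => w; ring.
apply: (le_trans (Ex_normr _ _)); first by bmt.
apply: (@le_trans _ _ (E (fun w => M * `|cmean P Y W w - E Y|))).
  by apply: ler_Ex; [bmt|bmt|] => w; rewrite normrM mulrC ler_wpM2r.
rewrite ExZ; last by bmt.
apply: ler_wpM2l => //; apply: Ex_norm_le; [bmt|exact: ltW|].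
by move: d; under eq_Ex do rewrite cmean0.
Qed.

Variable c0 : R.
Hypothesis c0_gt0 : 0 < c0.
Hypothesis condB : forall (y : U) (A : set Om), FJ U u0 (~` [set origin]) A -> (0 < P A)%E ->
  (c0%:E * P A < P (A `&` [set w : Om | w origin = y]))%E.

Let M := - ln c0.

Lemma info_max_gt0 : 0 < M.
Proof. by rewrite oppr_gt0 ln_lt0// c0_gt0 (c0_lt1 statP c0_gt0 condB). Qed.

Lemma info_le_max W w : finite_set W -> ~ W origin -> 0 <= info P W w <= M.
Proof. exact: (info_bounds statP c0_gt0 condB). Qed.

Lemma finite_pattern_past lam K b : finite_set (@pattern_past R lam K b).
Proof.
apply: (@sub_finite_set _ _ ((fun i : nat => (- i.+1%:Z,
    Num.floor (lam * (- i.+1%:Z)%:~R) + 1 - (nth false b i : nat)%:Z) : Z2) @` `I_K)); last first.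
  by apply: finite_image; exact: finite_II.
move=> _ [z [/andP[Kz z0] ->]]; exists (`|z|.-1)%N => /=; first by lia.
by have -> : - (`|z|.-1.+1)%:Z = z :> int by lia.
Qed.

Lemma pattern_past_origin lam K b : ~ @pattern_past R lam K b origin.
Proof. by move=> [z [/andP[_ z0] [z0' _]]]; rewrite -z0' ltxx in z0. Qed.

(** For fixed [K] there are only finitely many shapes of the recent past, one per boolean tuple, so
    the largest of their [D] serves all intercepts. Dividing by [M] brings the information into
    $[0,1]$. *)
Lemma info_mixing lam K e : 0 < e -> exists D : nat, forall (t : R) W (h : Om -> R), 0 <= t < 1 ->
  finite_set W -> local_on W h -> (forall v, W v -> (D < `|v.1|)%N) -> (forall w, `|h w| <= M) ->
  `|E (fun w => info P (recent_past lam t K) w * h w) -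
    E (info P (recent_past lam t K)) * E h| <= e.
Proof.
move=> e0; have Mp := info_max_gt0; pose d := e / M ^+ 2.
have d0 : 0 < d by rewrite divr_gt0 ?exprn_gt0.
pose Y (b : K.-tuple bool) w := M^-1 * info P (pattern_past lam K b) w.
have bI (b : K.-tuple bool) := info_bmeas P (finite_pattern_past lam K b).
have bY b : bmeas (Y b) by apply: bmeasZ.
have Y01 b w : 0 <= Y b w <= 1.
  have /andP[i1 i2] := info_le_max w (finite_pattern_past lam K b) (@pattern_past_origin lam K b).
  rewrite /Y mulr_ge0 ?invr_ge0 ?(ltW Mp)//=.
  by rewrite mulrC ler_pdivrMr// mul1r.
have /choice[D hD] b := mixing (bY b) (Y01 b) d0.
exists (\max_b D b)%N => t W h t01 fW lh WD hM.
have bh := loc_bmeas fW lh.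
rewrite recent_pastE//.
have sz : size [seq t < s | s <- thresholds lam K] == K by rewrite !size_map size_iota.
have hv u : W u -> (D (Tuple sz) < `|u.1|)%N.
  by move=> /WD; apply: leq_ltn_trans; exact: (leq_bigmax (F := D)).
have := hD (Tuple sz) W h M fW lh hv hM.
rewrite /Y/=; set W0 := pattern_past lam K _.
have bW : bmeas (info P W0) by exact: (bI (Tuple sz)).
have -> : E (fun w => M^-1 * info P W0 w * h w) = M^-1 * E (fun w => info P W0 w * h w).
  by rewrite -ExZ; [apply: eq_Ex => w; rewrite mulrA|bmt].
rewrite ExZ// -mulrA -mulrBr normrM ger0_norm ?invr_ge0 ?(ltW Mp)//.
rewrite ler_pdivrMl// /d.
by have -> : M * (M * (e / M ^+ 2)) = e by field; rewrite gt_eqF.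
Qed.

(** For each [k] at most [2 * D + 1] indices lie within distance [D]; their products are bounded by
    [M ^+ 2], all other covariances by [e]. *)
Lemma variance_bound (X : nat -> Om -> R) (D N : nat) e : (forall k, bmeas (X k)) ->
  0 <= e -> (forall k w, `|X k w| <= M) ->
  (forall k l, (k + D < l)%N -> `|E (fun w => X k w * X l w)| <= e) ->
  E (fun w => (\sum_(k < N) X k w) ^+ 2) <= N%:R * (N%:R * e + M ^+ 2 * (2 * D + 1)%N%:R).
Proof.
move=> bX e0 XM cov; have Mp := info_max_gt0.
have -> : E (fun w => (\sum_(k < N) X k w) ^+ 2) =
    \sum_(k < N) \sum_(l < N) E (fun w => X k w * X l w).
  transitivity (E (fun w => \sum_(k < N) \sum_(l < N) X k w * X l w)).
    apply: eq_Ex => w; rewrite expr2 mulr_suml; apply: eq_bigr => k _.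
    by rewrite mulr_sumr.
  rewrite Ex_sum; last by move=> k; bmt.
  by apply: eq_bigr => k _; rewrite Ex_sum// => l; bmt.
have covb k l : E (fun w => X k w * X l w) <=
    e + M ^+ 2 * ((k - D <= l)%N && (l < k + D + 1)%N)%:R.
  have [kl|lk] := ltnP (k + D) l.
    apply: le_trans (ler_norm _) _; apply: le_trans (cov _ _ kl) _.
    by rewrite lerDl mulr_ge0// sqr_ge0.
  have [kl|kl] := ltnP (l + D) k.
    under eq_Ex do rewrite mulrC.
    apply: le_trans (ler_norm _) _; apply: le_trans (cov _ _ kl) _.
    by rewrite lerDl mulr_ge0// sqr_ge0.
  have -> : (k - D <= l)%N && (l < k + D + 1)%N by lia.
  rewrite mulr1; apply: Ex_le_ub => [|w]; first by bmt.
  apply: le_trans (ler_norm _) _; rewrite normrM expr2.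
  apply: (@le_trans _ _ (M * M)); first by apply: ler_pM.
  by rewrite lerDr.
apply: (@le_trans _ _ (\sum_(k < N) (N%:R * e + M ^+ 2 * (2 * D + 1)%N%:R))); last first.
  by rewrite sumr_const card_ord -[leLHS]mulr_natl.
apply: ler_sum => k _.
apply: (@le_trans _ _ (\sum_(l < N) (e + M ^+ 2 * ((k - D <= l)%N && (l < k + D + 1)%N)%:R))).
  by apply: ler_sum => l _; exact: covb.
rewrite big_split/= sumr_const card_ord mulr_natl lerD2l -mulr_sumr.
apply: ler_wpM2l; first by rewrite sqr_ge0.
by apply: le_trans (@sum_window R _ _ N _) _; [lia|rewrite ler_nat; lia].
Qed.

Section Averages.
Variables (lam a : R) (z0 : int).
Let t := intercept lam (lam * z0%:~R + a).
Let v := line lam a z0.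
(** [K] is the memory length and [k] the position: [g k k] is the exact chain-rule term, while
    [g K k] keeps [K] sites of the past. *)
Let g K k := info P (recent_past lam (t k) K).
Let m K k := E (g K k).
Let X K k w := g K k (sh (v k) w) - m K k.

Lemma intercept_bounds k : 0 <= t k < 1.
Proof. exact: fpart_bounds. Qed.

Lemma past_info_bmeas K k : bmeas (g K k).
Proof. by apply: info_bmeas; exact: finite_recent_past. Qed.

Lemma past_info_bounds K k w : 0 <= g K k w <= M.
Proof.
by apply: info_le_max; [exact: finite_recent_past|exact: recent_past_origin].
Qed.

Lemma mean_info_bounds K k : 0 <= m K k <= M.
Proof.
apply/andP; split; first by apply: Ex_ge0 => w; case/andP: (past_info_bounds K k w).
by apply: Ex_le_ub => [|w]; [exact: past_info_bmeas|case/andP: (past_info_bounds K k w)].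
Qed.

Lemma finite_past_origin K k : finite_set (recent_past lam (t k) K `|` [set origin]).
Proof. by apply: finite_setU1; exact: finite_recent_past. Qed.

Lemma shift_info_bmeas K k u : bmeas (fun w => g K k (sh u w)).
Proof.
apply: (loc_bmeas (finite_translate u (finite_past_origin K k))).
by apply: loc_shift; exact: loc_info.
Qed.

Lemma Ex_shift_info K k u : E (fun w => g K k (sh u w)) = m K k.
Proof. exact: (Ex_shift statP u (finite_past_origin K k) (@loc_info _ _ _ P _)). Qed.

Lemma deviation_bmeas K k : bmeas (X K k).
Proof. by apply: bmeasB; [exact: shift_info_bmeas|exact: bmeas_cst]. Qed.

Lemma deviation_bound K k w : `|X K k w| <= M.
Proof.
have /andP[h1 h2] := past_info_bounds K k (sh (v k) w); have /andP[h3 h4] := mean_info_bounds K k.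
by rewrite /X ler_norml; apply/andP; split; lra.
Qed.

Lemma deviation_cov K D e : (forall (t : R) W (h : Om -> R), 0 <= t < 1 ->
  finite_set W -> local_on W h -> (forall v, W v -> (D < `|v.1|)%N) -> (forall w, `|h w| <= M) ->
  `|E (fun w => info P (recent_past lam t K) w * h w) -
    E (info P (recent_past lam t K)) * E h| <= e) ->
  forall k l, (k + (D + K) < l)%N -> `|E (fun w => X K k w * X K l w)| <= e.
Proof.
move=> mix k l kl.
(* Shifting back by [v k] puts the first factor at the origin. The second then sits around [u], and
   its past reaches back at most [K] columns, so it stays more than [D] columns away. *)
pose u := addZ2 (v l) (oppZ2 (v k)).
have ulk : v l = addZ2 u (v k) by rewrite addZ2NK.
pose W := translate u (recent_past lam (t l) K `|` [set origin]).
have fW : finite_set W by apply: finite_translate; exact: finite_past_origin.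
have lh : local_on W (fun w => g K l (sh u w)) by apply: loc_shift; exact: loc_info.
have b1 := shift_info_bmeas K k (v k); have b2 := shift_info_bmeas K l (v l).
have -> : E (fun w => X K k w * X K l w) =
    E (fun w => g K k w * g K l (sh u w)) - m K k * m K l.
  have -> : E (fun w => X K k w * X K l w) =
     E (fun w => g K k (sh (v k) w) * g K l (sh (v l) w) - (m K l * g K k (sh (v k) w)
       + m K k * g K l (sh (v l) w) - m K k * m K l)).
    by apply: eq_Ex => w; rewrite /X; ring.
  rewrite ExB; [|bmt|bmt]; rewrite ExB; [|bmt|bmt]; rewrite ExD; [|bmt|bmt].
  rewrite (ExZ P (m K l) b1) (ExZ P (m K k) b2) Ex_cst (Ex_shift_info K k (v k)) (Ex_shift_info K l (v l)).
  have -> : E (fun w => g K k (sh (v k) w) * g K l (sh (v l) w)) =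
      E (fun w => g K k w * g K l (sh u w)).
    have fU : finite_set ((recent_past lam (t k) K `|` [set origin]) `|` W).
      by rewrite finite_setU; split => //; exact: finite_past_origin.
    have lU : local_on ((recent_past lam (t k) K `|` [set origin]) `|` W)
        (fun w => g K k w * g K l (sh u w)).
      apply: (loc_comp2 (fun x y : R => x * y)).
        by apply: loc_sub (@loc_info _ _ _ P _); exact: subsetUl.
      by apply: loc_sub lh; exact: subsetUr.
    rewrite -(Ex_shift statP (v k) fU lU); apply: eq_Ex => w.
    by rewrite shift_shift -ulk.
  by ring.
rewrite -(Ex_shift_info K l u); apply: (mix _ W) => //; first exact: intercept_bounds.
  move=> _ [x hx <-]; rewrite /u /v /line/=.
  case: hx => [[z [/andP[z1 z2] ->]]|->] /=; lia.
by move=> w; have /andP[h1 h2] := past_info_bounds K l (sh u w); rewrite ger0_norm.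
Qed.

Lemma Info_line N w : Info P (v @` `I_N) w = \sum_(k < N) g k k (sh (v k) w).
Proof.
rewrite (Info_chain statP c0_gt0 condB)//; last exact: line_inj.
by apply: eq_bigr => k _; rewrite /v line_past.
Qed.

Lemma Info_line_bmeas N : bmeas (Info P (v @` `I_N)).
Proof.
have -> : Info P (v @` `I_N) = (fun w => \sum_(k < N) g k k (sh (v k) w)).
  by apply/funext => w; exact: Info_line.
by apply: bmeas_sum => k; exact: shift_info_bmeas.
Qed.

(** Each of the first [K] positions, whose past is shorter than [K], costs at most [M]; every later
    one costs at most [e]. *)
Lemma memory_truncation K e N : 0 <= e -> (forall (t : R) k, (K <= k)%N ->
    E (fun w => `|info P (recent_past lam t k) w - info P (recent_past lam t K) w|) <= e) ->
  E (fun w => `|\sum_(k < N) (g k k (sh (v k) w) - g K k (sh (v k) w))|) <= N%:R * e + M * K%:R.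
Proof.
move=> e0 hK; have bg K' k := shift_info_bmeas K' k (v k).
apply: (@le_trans _ _ (E (fun w => \sum_(k < N) `|g k k (sh (v k) w) - g K k (sh (v k) w)|))).
  apply: ler_Ex => [||w]; last exact: ler_norm_sum.
  - by apply: bmeas_norm; apply: bmeas_sum => k; apply: bmeasB.
  - by apply: bmeas_sum => k; apply: bmeas_norm; apply: bmeasB.
rewrite Ex_sum; last by move=> k; apply: bmeas_norm; apply: bmeasB.
apply: (@le_trans _ _ (\sum_(k < N) (e + M * ((0 <= k)%N && (k < K)%N)%:R))).
  apply: ler_sum => k _.
  have -> : E (fun w => `|g k k (sh (v k) w) - g K k (sh (v k) w)|) =
      E (fun w => `|g k k w - g K k w|).
    have fU : finite_set ((recent_past lam (t k) k `|` [set origin]) `|`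
       (recent_past lam (t k) K `|` [set origin])).
      by rewrite finite_setU; split; exact: finite_past_origin.
    apply: (Ex_shift statP (v k) fU (f := fun w => `|g k k w - g K k w|)).
    apply: (loc_comp2 (fun x y : R => `|x - y|)).
      by apply: loc_sub (@loc_info _ _ _ P _); exact: subsetUl.
    by apply: loc_sub (@loc_info _ _ _ P _); exact: subsetUr.
  have [Kk|kK] /= := leqP K k; first by rewrite mulr0 addr0; exact: hK.
  have b1 := past_info_bmeas k k; have b2 := past_info_bmeas K k.
  rewrite mulr1; apply: Ex_le_ub => [|w]; first by bmt.
  have /andP[h1 h2] := past_info_bounds k k w; have /andP[h3 h4] := past_info_bounds K k w.
  by rewrite ler_norml; apply/andP; split; lra.
rewrite big_split/= sumr_const card_ord mulr_natl lerD2l -mulr_sumr.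
apply: ler_wpM2l; first exact: ltW info_max_gt0.
by have := @sum_window R 0 K N (leq0n _); rewrite subn0.
Qed.

(** The error has five sources: truncated memory [e1], fluctuations [2 * e2], the mean of the
    truncated information [e4], the first [K] sites, and the discrepancy [C] of the intercepts. *)
Lemma line_average K N D (e1 e2 C Im h e4 : R) (f : R -> R) : (0 < N)%N -> 0 <= e1 -> 0 <= e2 ->
  (forall (t : R) k, (K <= k)%N ->
    E (fun w => `|info P (recent_past lam t k) w - info P (recent_past lam t K) w|) <= e1) ->
  (forall k l, (k + D < l)%N -> `|E (fun w => X K k w * X K l w)| <= e2 ^+ 2) ->
  M ^+ 2 * (2 * D + 1)%N%:R <= N%:R * e2 ^+ 2 ->
  (forall t, 0 <= t < 1 -> f t = E (info P (recent_past lam t K))) ->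
  `|\sum_(k < N) f (t k) - N%:R * Im| <= C ->
  `|Im - h| <= e4 ->
  E (fun w => `|N%:R^-1 * Info P (v @` `I_N) w - h|) <=
    e1 + 2 * e2 + e4 + (M * K%:R + C) / N%:R.
Proof.
move=> N0 e10 e20 hK cov hN fE hC hh.
have N0' : 0 < N%:R :> R by rewrite ltr0n.
have bX k := deviation_bmeas K k.
have bS : bmeas (fun w => \sum_(k < N) X K k w) by apply: bmeas_sum.
have bg K' k := shift_info_bmeas K' k (v k).
have bT : bmeas (fun w => \sum_(k < N) (g k k (sh (v k) w) - g K k (sh (v k) w))).
  by apply: bmeas_sum => k; apply: bmeasB.
have bI := Info_line_bmeas N.
have hT := memory_truncation N e10 hK.
(* The variance is at most $2N^2e_2^2$, which is below $(2Ne_2)^2$. *)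
have hS : E (fun w => `|\sum_(k < N) X K k w|) <= N%:R * (2 * e2).
  apply: Ex_norm_le => //; first by rewrite !mulr_ge0.
  apply: (le_trans (variance_bound N bX (sqr_ge0 e2) (deviation_bound K) cov)).
  apply: (@le_trans _ _ (N%:R * (N%:R * e2 ^+ 2 + N%:R * e2 ^+ 2))).
    by rewrite ler_pM2l// lerD2l.
  have -> : (N%:R * (2 * e2)) ^+ 2 = N%:R * (N%:R * e2 ^+ 2 + N%:R * e2 ^+ 2) +
      2 * (N%:R * e2) ^+ 2 by ring.
  by rewrite lerDl mulr_ge0// sqr_ge0.
pose c := N%:R^-1 * C + e4.
apply: (@le_trans _ _ (E (fun w => N%:R^-1 *
   (`|\sum_(k < N) (g k k (sh (v k) w) - g K k (sh (v k) w))| + `|\sum_(k < N) X K k w|) + c))).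
  apply: ler_Ex => [||w].
  - by bmt.
  - by bmt.
  have -> : N%:R^-1 * Info P (v @` `I_N) w - h =
      N%:R^-1 * (\sum_(k < N) (g k k (sh (v k) w) - g K k (sh (v k) w)) + \sum_(k < N) X K k w)
      + (N%:R^-1 * (\sum_(k < N) f (t k) - N%:R * Im) + (Im - h)).
    have -> : \sum_(k < N) f (t k) = \sum_(k < N) m K k.
      by apply: eq_bigr => k _; rewrite fE//; exact: intercept_bounds.
    have hsum : \sum_(k < N) (g k k (sh (v k) w) - g K k (sh (v k) w)) + \sum_(k < N) X K k w =
        \sum_(k < N) g k k (sh (v k) w) - \sum_(k < N) m K k.
      by rewrite -big_split/= -sumrB; apply: eq_bigr => k _; rewrite /X; ring.
    rewrite Info_line hsum [in RHS]mulrBr [X in _ = _ + (X + _)]mulrBr mulKf ?gt_eqF//; ring.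
  apply: (le_trans (ler_normD _ _)); apply: lerD.
    by rewrite normrM ger0_norm ?invr_ge0// ler_pM2l ?invr_gt0//; exact: ler_normD.
  apply: (le_trans (ler_normD _ _)); apply: lerD => //.
  by rewrite normrM ger0_norm ?invr_ge0// ler_pM2l ?invr_gt0.
rewrite ExD; [|bmt|bmt]; rewrite ExZ; last by bmt.
rewrite ExD; [|bmt|bmt]; rewrite Ex_cst /c.
have -> : e1 + 2 * e2 + e4 + (M * K%:R + C) / N%:R =
  N%:R^-1 * ((N%:R * e1 + M * K%:R) + N%:R * (2 * e2)) + (N%:R^-1 * C + e4).
  by field; rewrite gt_eqF.
by rewrite lerD2r ler_pM2l ?invr_gt0//; exact: lerD.
Qed.

End Averages.

Section Entropy.
Variables (lam : R) (q : R -> Om -> U -> R).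
Hypothesis qP : forall t : R, is_cond_law P (past U u0 lam t) (q t).

Let H := past_entropy P c0 q.

Lemma past_entropy_approx e : 0 < e -> exists K, forall k, (K <= k)%N ->
  exists f, [/\ equidistributed lam f,
    forall t, 0 <= t < 1 -> f t = E (info P (recent_past lam t k)) &
    forall t, 0 <= t < 1 -> `|H t - f t| <= e].
Proof.
move=> e0; have [K hK] := past_entropy_uniform statP H01 c0_gt0 condB qP e0.
exists K => k Kk; have [f [ef fE]] := equidistributed_past lam k (fun W => E (info P W)).
by exists f; split => // s s01; rewrite fE//; exact: hK.
Qed.

(** The versions [q t] are chosen separately for each [t], so measurability in [t] comes from the
    limit: [H] is a pointwise limit on $[0,1)$ of functions of the pattern of the past. One
    approximant within 1 gives boundedness. *)
Lemma past_entropy_integrable : lebesgue_measure.-integrable (@unit_itv R) (EFin \o H).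
Proof.
have [K hK] := past_entropy_approx ltr01.
have [f [[bf _] _ fH]] := hK K (leqnn K).
have [mf [B fB]] := bf.
apply: (@bmeas_integrable01 R H (1 + B)).
  have /choice[F hF] : forall k, exists f, equidistributed lam f /\
      forall t, 0 <= t < 1 -> f t = E (info P (recent_past lam t k)).
    by move=> k; exact: (equidistributed_past lam k (fun W => E (info P W))).
  apply: (@measurable_fun_cvg _ _ _ (@unit_itv R) F).
    by move=> k; have [[[mF _] _] _] := hF k; exact: measurable_funS mF.
  move=> s; rewrite /unit_itv/= in_itv/= => s01; apply/cvgrPdist_le => e e0.
  have [K' hK'] := past_entropy_approx e0.
  exists K' => // k /= Kk; have [f' [_ f'E f'H]] := hK' k Kk.
  by have [_ ->//] := hF k; rewrite -f'E//; exact: f'H.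
move=> s s01; rewrite -(subrK (f s) (H s)); apply: (le_trans (ler_normD _ _)).
by apply: lerD; [exact: fH|exact: fB].
Qed.

(** Clipping changes each inner integrand only on a null set, and the right endpoint of $[0,1]$ has
    measure zero. *)
Lemma spec_entropyE : spec_entropy P lam q = (mean01 H)%:E.
Proof.
have iH := past_entropy_integrable.
rewrite /spec_entropy.
transitivity (\int[lebesgue_measure]_(s in `[0%R, 1%R]) (H s)%:E)%E.
  apply: eq_integral => s _.
  exact: (integral_Hent statP c0_gt0 condB (@full_past_origin R lam s) (qP s)).
rewrite -integral_itv_bndo_bndc; last exact: measurable_int iH.
rewrite /mean01 /Rintegral fineK//.
apply: (integrable_fin_num _ iH); exact: measurable_unit_itv.
Qed.

Lemma mean01_near e : 0 < e -> exists K, forall k, (K <= k)%N ->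
  exists f, [/\ equidistributed lam f,
    forall t, 0 <= t < 1 -> f t = E (info P (recent_past lam t k)) &
    `|mean01 f - mean01 H| <= e].
Proof.
move=> e0; have [K hK] := past_entropy_approx e0; exists K => k Kk.
have [f [ef fE fH]] := hK k Kk; exists f; split => //.
have mI := @measurable_unit_itv R.
have iF := bmeas_integrable_unit ef.1; have iH := past_entropy_integrable.
have iB : lebesgue_measure.-integrable (@unit_itv R) (EFin \o (fun s => f s - H s)).
  exact: (integrableB _ iF iH).
rewrite /mean01 -RintegralB//; apply: (le_trans (le_normr_Rintegral _ _)) => //.
rewrite -[leRHS]mean01_cst; apply: le_Rintegral => //.
- exact: (integrable_norm iB).
- by apply: bmeas_integrable_unit; exact: bmeas_cst.
by move=> s; rewrite /unit_itv/= in_itv/= => s01; rewrite distrC; exact: fH.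
Qed.

Lemma uniform_law_of_large_numbers e : 0 < e -> exists N0, forall N, (N0 <= N)%N ->
  forall a z0, E (fun w => `|N%:R^-1 * Info P (line lam a z0 @` `I_N) w - mean01 H|) <= e.
Proof.
move=> e0; have Mp := info_max_gt0.
(* The terms [e1], [2 * e2], [e4] and the one divided by [N] will each be at most [e / 5]. *)
have e50 : 0 < e / 5%:R by lra.
have e100 : 0 < e / 10%:R by lra.
have [K1 hK1] := info_past_stable statP H01 c0_gt0 condB lam e50.
have [K2 hK2] := mean01_near e50.
pose K := maxn K1 K2.
have [f [[bf [C hC]] fE fh]] := hK2 K (leq_maxr _ _).
have [D hD] := info_mixing lam K (exprn_gt0 2 e100).
(* [N >= B1] makes the near-diagonal covariances negligible; [N >= B2] does the same for the first
   sites and the discrepancy. *)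
pose B1 := M ^+ 2 * (2 * (D + K) + 1)%N%:R / (e / 10%:R) ^+ 2.
pose B2 := (M * K%:R + C) / (e / 5%:R).
exists (maxn 1 (maxn (Num.truncn B1).+1 (Num.truncn B2).+1)) => N hN a z0.
move: hN; rewrite !geq_max => /and3P[N0 hB1 hB2].
have N0' : 0 < N%:R :> R by rewrite ltr0n.
have NB1 : B1 <= N%:R.
  by apply: le_trans (ltW (truncnS_gt B1)) _; rewrite ler_nat.
have NB2 : B2 <= N%:R.
  by apply: le_trans (ltW (truncnS_gt B2)) _; rewrite ler_nat.
apply: (le_trans (@line_average lam a z0 K N (D + K) (e / 5%:R) (e / 10%:R) C (mean01 f)
  (mean01 H) (e / 5%:R) f N0 (ltW e50) (ltW e100) _ _ _ fE _ fh)).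
- by move=> s k Kk; apply: hK1; [exact: leq_trans (leq_maxl _ _) Kk|exact: leq_maxl].
- exact: deviation_cov hD.
- by move: NB1; rewrite /B1 ler_pdivrMr ?exprn_gt0.
- exact: hC.
have : (M * K%:R + C) / N%:R <= e / 5%:R.
  by move: NB2; rewrite /B2 !ler_pdivrMr//; lra.
lra.
Qed.

End Entropy.

End Main.

Unset Implicit Arguments.

Theorem theorem4p1 (R : realType) (U : finType) (u0 : U)
    (P : probability (OmegaM U u0) R) (lam x x' : R)
    (q : R -> OmegaM U u0 -> U -> R) :
  stationary P -> strong_01_law P -> condition_B P ->
  0 <= lam <= 1 -> x < x' ->
  (forall t : R, is_cond_law P (past U u0 lam t) (q t)) ->
  (fun n : nat =>
     ereal_sup (range (fun b : R =>
       \int[P]_w `| ((cardZ2 R (Ln lam x x' n b))^-1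
                      * Info P (Ln lam x x' n b) w)%:E
                    - spec_entropy P lam q |)%E)) @ \oo --> 0%E.
Proof.
move=> statP H01 [c0 [c0_gt0 condB]] _ xx qP.
rewrite (spec_entropyE statP H01 c0_gt0 condB qP).
set h := mean01 _.
set S := fun n : nat => ereal_sup _.
have S0 n : (0 <= S n)%E.
  apply: le_ereal_sup_tmp; eexists; first by exists 0.
  by apply: integral_ge0 => w _; exact: abse_ge0.
have Se e : 0 < e -> \forall n \near \oo, (S n <= e%:E)%E.
  move=> e0.
  have [N0 hN0] := uniform_law_of_large_numbers statP H01 c0_gt0 condB qP e0.
  (* A segment has at least [n%:R * (x' - x) - 1] sites for every [b], so this [n0] gives at least
     [N0] of them uniformly in [b]. *)
  pose n0 := (Num.truncn ((N0%:R + 1) / (x' - x))).+1.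
  exists n0 => // n /= n0n; apply: ge_ereal_sup => _ [b _ <-].
  have [z0 [N [-> hN]]] := Ln_line lam n b xx.
  have xx0 : 0 < x' - x by rewrite subr_gt0.
  have NN : (N0 <= N)%N.
    rewrite -(ler_nat R).
    have : (N0%:R + 1) / (x' - x) <= n%:R.
      by apply: le_trans (ltW (truncnS_gt _)) _; rewrite ler_nat.
    by rewrite ler_pdivrMr//; lra.
  rewrite card_line.
  have bI := Info_line_bmeas statP c0_gt0 condB lam (n%:R * b) z0 N.
  under eq_integral do rewrite -EFinB abse_EFin.
  rewrite EFin_Ex ?lee_fin; first exact: hN0.
  by bmt.
apply/fine_cvgP; split.
  apply: filterS (Se _ ltr01) => n Sn.
  by rewrite ge0_fin_numE ?S0//; exact: le_lt_trans Sn (ltry _).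
apply/cvgrPdist_le => e e0; apply: filterS (Se _ e0) => n Sn.
have fS : S n \is a fin_num by rewrite ge0_fin_numE ?S0//; exact: le_lt_trans Sn (ltry _).
rewrite sub0r normrN ger0_norm ?fine_ge0 ?S0//.
by rewrite -lee_fin fineK.
Qed.
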